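(* Let $w$ be the $A1_\epsilon$ universal weight system. Let $D$ be a chord diagram and $a$ a fixed chord of $D$. Suppose that exactly $k$ chords $b_1,\dots,b_k$ of $D$ intersect $a$. Then $w(D)$ is a polynomial in $c$ and $y$, and it satisfies the recurrence relation $$\begin{aligned} w(D)=\ &(c-\epsilon k)\,w(D_a)+\epsilon(c-y)\sum_{i}w(D_{a,i})+\epsilon\sum_{i<j}\big(w(D_{a,ij}^{\parallel})-w(D_{a,ij}^{\times})\big)\\ &+\epsilon(c-y)\sum_{i<j}\big(w(D_{a,ij}^{\ell r})+w(D_{a,ij}^{r\ell})-w(D_{a,ij}^{\ell\ell})-w(D_{a,ij}^{rr})\big), \end{aligned}$$ where $1\le i\le k$ in the first sum and $1\le i<j\le k$ in the others. Here $D_a=D-a$, $D_{a,i}=D-a-b_i$, $D_{a,ij}=D-a-b_i-b_j$. Drawing $D$ with the chord $a$ vertical, so that each $b_i$ has one left endpoint and one right endpoint (on the two arcs cut out by $a$), the remaining diagrams are obtained from $D_{a,ij}$ by adding new chords as follows: $D_{a,ij}^{\parallel}$: one chord joining the left ends of $b_i$ and $b_j$ and one chord joining the right ends of $b_i$ and $b_j$; $D_{a,ij}^{\times}$: one chord joining the left end of $b_i$ to the right end of $b_j$ and one chord joining the right end of $b_i$ to the left end of $b_j$; $D_{a,ij}^{\ell r}$: a single chord joining the left end of $b_i$ to the right end of $b_j$; $D_{a,ij}^{r\ell}$: a single chord joining the right end of $b_i$ to the left end of $b_j$; $D_{a,ij}^{\ell\ell}$: a single chord joining the left ends of $b_i$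 and $b_j$; $D_{a,ij}^{rr}$: a single chord joining the right ends of $b_i$ and $b_j$.
   Context: Let $\mathbb{K}$ be a field of characteristic zero and $\epsilon\in\{1,-1\}$. $A1_\epsilon$ is the four-dimensional $\mathbb{Z}_2\times\mathbb{Z}_2$-graded Lie algebra with basis $Q_0=H,Q_1,Q_2,Q_3$ of degrees $(0,0),(1,0),(0,1),(1,1)$ and relations $[H,Q_k]=0$, $\{Q_1,Q_2\}=Q_3$, $\{Q_2,Q_3\}=\epsilon Q_1$, $\{Q_3,Q_1\}=Q_2$. Its universal enveloping algebra $\mathcal{U}$ is the unital associative $\mathbb{K}$-algebra generated by $Q_0,Q_1,Q_2,Q_3$ with relations $Q_0Q_k=Q_kQ_0$ $(k=1,2,3)$, $Q_1Q_2+Q_2Q_1=Q_3$, $Q_2Q_3+Q_3Q_2=\epsilon Q_1$, $Q_3Q_1+Q_1Q_3=Q_2$. Put $b^{(0)}=1$, $b^{(1)}=\epsilon$, $b^{(2)}=b^{(3)}=1$, $c=Q_0^2+\epsilon Q_1^2+Q_2^2+Q_3^2$ (the central Casimir element) and $y=c-Q_0^2$. For $\mu,\nu\in\{0,1,2,3\}$ let $\sigma(\mu,\nu)=-1$ if $\mu,\nu$ are distinct and both nonzero, and $\sigma(\mu,\nu)=1$ otherwise. A chord diagram of order $n$ is an oriented circle with $2n$ distinct points grouped into $n$ pairs (chords), up to orientation-preserving homeomorphism. Two chords intersect if their endpoints alternate along the circle. Removing a chord removes its endpoints. The $A1_\epsilon$ universal weight system $w$ (for framed knots) is defined on a chord diagram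 $D$ of order $n$ as follows: cut the circle at a point which is not an endpoint, and let $p_1,\dots,p_{2n}$ be the endpoints in the order of the orientation. Then $$w(D)=\sum_{\mu}\ \prod_{e}b^{(\mu(e))}\ \prod_{\{e,e'\}}\sigma(\mu(e),\mu(e'))\ \ Q_{\mu(p_1)}Q_{\mu(p_2)}\cdots Q_{\mu(p_{2n})}\in Z(\mathcal{U}),$$ where $\mu$ runs over all maps from the set of chords to $\{0,1,2,3\}$, $e$ runs over the chords, $\{e,e'\}$ runs over the unordered pairs of intersecting chords, and $\mu(p_k)$ is the label of the chord ending at $p_k$; $w$ of the diagram without chords is $1$. In an identity between several diagrams sharing the same circle, all of them are cut at the same point. *)

(* Defs.v *)
From HB Require Import structures.
From mathcomp Require Import all_boot all_order all_algebra.
From mathcomp Require Import boolp monalg.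

Set Implicit Arguments.
Unset Strict Implicit.
Unset Printing Implicit Defensive.

Import GRing.Theory.
Local Open Scope ring_scope.

(* The enveloping algebra of A1_eps: the free associative algebra on four     *)
(* generators, i.e. the algebra of the free monoid on 'I_4, modulo the        *)
(* two-sided ideal generated by the relators.                                 *)
Section EnvelopingAlgebra.
Variables (K : fieldType) (eps : K).

Local Notation free_alg := {malg K[{fmonom 'I_4}]}.

Definition free_gen (i : 'I_4) : free_alg := << fmu i >>.

Local Notation X i := (free_gen (inord i)).

Inductive relator : free_alg -> Prop :=
| relator01 : relator (X 0 * X 1 - X 1 * X 0)
| relator02 : relator (X 0 * X 2 - X 2 * X 0)
| relator03 : relator (X 0 * X 3 - X 3 * X 0)
| relator12 : relator (X 1 * X 2 + X 2 * X 1 - X 3)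
| relator23 : relator (X 2 * X 3 + X 3 * X 2 - eps *: X 1)
| relator31 : relator (X 3 * X 1 + X 1 * X 3 - X 2).

Inductive rel_ideal : free_alg -> Prop :=
| rel_ideal_gen r : relator r -> rel_ideal r
| rel_ideal0 : rel_ideal 0
| rel_idealD x y : rel_ideal x -> rel_ideal y -> rel_ideal (x + y)
| rel_idealMl z x : rel_ideal x -> rel_ideal (z * x)
| rel_idealMr z x : rel_ideal x -> rel_ideal (x * z).

Definition rel_pred : {pred free_alg} := fun x => `[< rel_ideal x >].

Lemma rel_predP x : reflect (rel_ideal x) (x \in rel_pred).
Proof. exact: asboolP. Qed.

Fact rel_pred_zmod_closed : zmod_closed rel_pred.
Proof.
split=> [|x y /rel_predP Ix /rel_predP Iy]; apply/rel_predP.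
  exact: rel_ideal0.
by apply: rel_idealD => //; rewrite -mulN1r; apply: rel_idealMl.
Qed.

HB.instance Definition _ :=
  GRing.isZmodClosed.Build free_alg rel_pred rel_pred_zmod_closed.

Definition envalg : Type := Quotient.quot rel_pred.

HB.instance Definition _ := GRing.Zmodule.on envalg.

Definition envalg_pi (x : free_alg) : envalg := \pi_(Quotient.quot rel_pred)%qT x.

Lemma envalg_piP (u : envalg) : exists x, u = envalg_pi x.
Proof. by exists (repr u); rewrite /envalg_pi reprK. Qed.

Lemma envalg_eqP x y : envalg_pi x = envalg_pi y <-> rel_ideal (x - y).
Proof.
rewrite /envalg_pi; split=> [/eqP|/rel_predP].
  by rewrite -Quotient.idealrBE => /rel_predP.
by rewrite Quotient.idealrBE => /eqP.
Qed.

Lemma envalg_piD : {morph envalg_pi : x y / x + y}.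
Proof. by move=> x y; rewrite /envalg_pi Quotient.pi_add. Qed.

Definition envalg_mul (u v : envalg) : envalg := envalg_pi (repr u * repr v).

Lemma envalg_piM x y : envalg_pi (x * y) = envalg_mul (envalg_pi x) (envalg_pi y).
Proof.
apply/envalg_eqP; set x' := repr _; set y' := repr _.
have xx' : rel_ideal (x - x') by apply/envalg_eqP; rewrite /envalg_pi reprK.
have yy' : rel_ideal (y - y') by apply/envalg_eqP; rewrite /envalg_pi reprK.
have -> : x * y - x' * y' = (x - x') * y + x' * (y - y').
  by rewrite mulrBl mulrBr addrA subrK.
by apply: rel_idealD; [apply: rel_idealMr | apply: rel_idealMl].
Qed.

Definition envalg_scale (a : K) (u : envalg) : envalg := envalg_pi (a *: repr u).

Lemma envalg_piZ a x : envalg_pi (a *: x) = envalg_scale a (envalg_pi x).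
Proof.
apply/envalg_eqP; rewrite -scalerBr -mul_malgC; apply: rel_idealMl.
by apply/envalg_eqP; rewrite /envalg_pi reprK.
Qed.

(* The augmentation (constant term) kills the ideal, so that 1 <> 0. *)
Definition aug (x : free_alg) : K := mcoeff (@mone _) x.

Lemma aug0B x y : aug x = 0 -> aug y = 0 -> aug (x - y) = 0.
Proof. by move=> ex ey; apply: etrans (mcoeffB _ _ _) _; rewrite -!/(aug _) ex ey subr0. Qed.

Lemma aug0D x y : aug x = 0 -> aug y = 0 -> aug (x + y) = 0.
Proof. by move=> ex ey; apply: etrans (mcoeffD _ _ _) _; rewrite -!/(aug _) ex ey addr0. Qed.

Lemma aug0Z a x : aug x = 0 -> aug (a *: x) = 0.
Proof. by move=> ex; apply: etrans (mcoeffZ _ _ _) _; rewrite -!/(aug _) ex mulr0. Qed.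

Lemma augM x y : aug (x * y) = aug x * aug y.
Proof. exact: (mcoeff1g_is_multiplicative _ _).1. Qed.

Lemma aug0M x y : aug y = 0 -> aug (x * y) = 0.
Proof. by rewrite augM => ->; rewrite mulr0. Qed.

Lemma aug_gen i : aug (free_gen i) = 0.
Proof.
rewrite /aug mcoeffU; case: eqP => // /(congr1 (@fmonom_val _)).
by rewrite fmU fm1.
Qed.

Lemma rel_ideal_aug (x : free_alg) : rel_ideal x -> aug x = 0.
Proof.
elim=> [r||y z _ Iy _ Iz|z y _ Iy|z y _ Iy].
- have comm0 i j :
      aug (free_gen i * free_gen j - free_gen j * free_gen i) = 0.
    exact: aug0B (aug0M _ (aug_gen _)) (aug0M _ (aug_gen _)).
  have anti0 i j : aug (free_gen i * free_gen j + free_gen j * free_gen i) = 0.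
    exact: aug0D (aug0M _ (aug_gen _)) (aug0M _ (aug_gen _)).
  case.
  + exact: comm0.
  + exact: comm0.
  + exact: comm0.
  + exact: aug0B (anti0 _ _) (aug_gen _).
  + exact: aug0B (anti0 _ _) (aug0Z _ (aug_gen _)).
  + exact: aug0B (anti0 _ _) (aug_gen _).
- exact: mcoeff0.
- exact: aug0D.
- exact: aug0M.
- by rewrite augM Iy mul0r.
Qed.

Fact envalg_mulA : associative envalg_mul.
Proof.
move=> u v w; have [x ->] := envalg_piP u; have [y ->] := envalg_piP v.
by have [z ->] := envalg_piP w; rewrite -!envalg_piM mulrA.
Qed.

Fact envalg_mul1 : left_id (envalg_pi 1) envalg_mul.
Proof. by move=> u; have [x ->] := envalg_piP u; rewrite -envalg_piM mul1r. Qed.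

Fact envalg_mulr1 : right_id (envalg_pi 1) envalg_mul.
Proof. by move=> u; have [x ->] := envalg_piP u; rewrite -envalg_piM mulr1. Qed.

Fact envalg_mulDl : left_distributive envalg_mul +%R.
Proof.
move=> u v w; have [x ->] := envalg_piP u; have [y ->] := envalg_piP v.
have [z ->] := envalg_piP w.
by rewrite -!(envalg_piM, envalg_piD) mulrDl.
Qed.

Fact envalg_mulDr : right_distributive envalg_mul +%R.
Proof.
move=> u v w; have [x ->] := envalg_piP u; have [y ->] := envalg_piP v.
have [z ->] := envalg_piP w.
by rewrite -!(envalg_piM, envalg_piD) mulrDr.
Qed.

Fact envalg_1neq0 : envalg_pi 1 != 0.
Proof.
apply/eqP=> e; have : rel_ideal (1 - 0).
  by apply/envalg_eqP; rewrite e -[0 in LHS](subrr (envalg_pi 0));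
     rewrite -{1}[0]addr0 envalg_piD addrK.
by rewrite subr0 => /rel_ideal_aug/eqP; rewrite /aug mcoeff1 eqxx oner_eq0.
Qed.

HB.instance Definition _ := GRing.Zmodule_isNzRing.Build envalg
  envalg_mulA envalg_mul1 envalg_mulr1 envalg_mulDl envalg_mulDr envalg_1neq0.

Fact envalg_scaleA a b u :
  envalg_scale a (envalg_scale b u) = envalg_scale (a * b) u.
Proof. by have [x ->] := envalg_piP u; rewrite -!envalg_piZ scalerA. Qed.

Fact envalg_scale1 : left_id 1 envalg_scale.
Proof. by move=> u; have [x ->] := envalg_piP u; rewrite -envalg_piZ scale1r. Qed.

Fact envalg_scaleDr : right_distributive envalg_scale +%R.
Proof.
move=> a u v; have [x ->] := envalg_piP u; have [y ->] := envalg_piP v.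
by rewrite -!(envalg_piZ, envalg_piD) scalerDr.
Qed.

Fact envalg_scaleDl u : {morph envalg_scale^~ u : a b / a + b}.
Proof.
by move=> a b; have [x ->] := envalg_piP u;
   rewrite -!envalg_piZ -envalg_piD scalerDl.
Qed.

HB.instance Definition _ := GRing.Zmodule_isLmodule.Build K envalg
  envalg_scaleA envalg_scale1 envalg_scaleDr envalg_scaleDl.

Fact envalg_scaleAl a (u v : envalg) : a *: (u * v) = a *: u * v.
Proof.
have [x ->] := envalg_piP u; have [y ->] := envalg_piP v.
by rewrite /GRing.scale /GRing.mul /= -!(envalg_piM, envalg_piZ) scalerAl.
Qed.

HB.instance Definition _ :=
  GRing.Lmodule_isLalgebra.Build K envalg envalg_scaleAl.

Fact free_scaleAr a (x y : free_alg) : a *: (x * y) = x * (a *: y).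
Proof.
have comm : malgC a * x = x * malgC a.
  apply: etrans (fgmulUg _ _ _) (etrans _ (esym (fgmulgU _ _ _))).
  by apply: eq_bigr => k _; rewrite mul1m mulm1 mulrC.
transitivity (malgC a * x * y); first by rewrite -mulrA; exact/esym/mul_malgC.
by rewrite comm -mulrA; congr (x * _); exact: mul_malgC.
Qed.

Fact envalg_scaleAr a (u v : envalg) : a *: (u * v) = u * (a *: v).
Proof.
have [x ->] := envalg_piP u; have [y ->] := envalg_piP v.
by rewrite /GRing.scale /GRing.mul /= -!(envalg_piM, envalg_piZ) free_scaleAr.
Qed.

HB.instance Definition _ :=
  GRing.Lalgebra_isAlgebra.Build K envalg envalg_scaleAr.

Definition Qgen (i : 'I_4) : envalg := envalg_pi (free_gen i).

Local Notation Q i := (Qgen (inord i)).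

Lemma envalg_relator x y : relator (x - y) -> envalg_pi x = envalg_pi y.
Proof. by move=> ?; apply/envalg_eqP; apply: rel_ideal_gen. Qed.

Lemma Qgen01 : Q 0 * Q 1 = Q 1 * Q 0.
Proof.
apply: etrans (esym (envalg_piM _ _)) _; apply: etrans (envalg_piM _ _).
exact: envalg_relator relator01.
Qed.

Lemma Qgen02 : Q 0 * Q 2 = Q 2 * Q 0.
Proof.
apply: etrans (esym (envalg_piM _ _)) _; apply: etrans (envalg_piM _ _).
exact: envalg_relator relator02.
Qed.

Lemma Qgen03 : Q 0 * Q 3 = Q 3 * Q 0.
Proof.
apply: etrans (esym (envalg_piM _ _)) _; apply: etrans (envalg_piM _ _).
exact: envalg_relator relator03.
Qed.

Lemma envalg_pi_anti x y :
  envalg_pi x * envalg_pi y + envalg_pi y * envalg_pi x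
  = envalg_pi (x * y + y * x).
Proof.
apply: esym; apply: etrans (envalg_piD _ _) _.
exact: congr2 (envalg_piM _ _) (envalg_piM _ _).
Qed.

Lemma Qgen12 : Q 1 * Q 2 + Q 2 * Q 1 = Q 3.
Proof. exact: etrans (envalg_pi_anti _ _) (envalg_relator relator12). Qed.

Lemma Qgen23 : Q 2 * Q 3 + Q 3 * Q 2 = eps *: Q 1.
Proof.
apply: etrans (envalg_pi_anti _ _) _; apply: etrans (envalg_piZ _ _).
exact: envalg_relator relator23.
Qed.

Lemma Qgen31 : Q 3 * Q 1 + Q 1 * Q 3 = Q 2.
Proof. exact: etrans (envalg_pi_anti _ _) (envalg_relator relator31). Qed.

Definition casimir : envalg :=
  Q 0 ^+ 2 + eps *: Q 1 ^+ 2 + Q 2 ^+ 2 + Q 3 ^+ 2.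

Definition casimir_y : envalg := casimir - Q 0 ^+ 2.

Definition form_coef (mu : 'I_4) : K := if mu == 1%N :> nat then eps else 1.

Definition color_sign (mu nu : 'I_4) : K :=
  if [&& mu != nu, mu != ord0 & nu != ord0] then -1 else 1.

End EnvelopingAlgebra.

(* The circle carries N marks, numbered from 0 along its orientation; a chord *)
(* is a pair of marks. Marks need not be used, so that diagrams obtained from *)
(* one another by removing and adding chords live on the same circle.         *)
Section ChordDiagrams.
Variable N : nat.
Implicit Types (p q x y z : 'I_N) (e f : {set 'I_N}) (D : {set {set 'I_N}}).

Definition chord_diagram D : bool :=
  [forall e in D, #|e| == 2] && trivIset D.

(* x, y, z are distinct and met in this order along the oriented circle. *)
Definition cyc x y z : bool :=
  [|| (x < y < z)%N, (y < z < x)%N | (z < x < y)%N].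

Definition crosses e f : bool :=
  [exists x in e, exists y in f, exists z in e, exists u in f,
    cyc x y z && cyc z u x].

Definition add_chord D p q : {set {set 'I_N}} := [set p; q] |: D.

Variables (K : fieldType) (eps : K).

(* The circle is cut just before the mark t. The labellings mu of the chords  *)
(* of D are extended by 0 outside D; comparing enum_rank selects each         *)
(* unordered pair of chords once.                                             *)
Definition weight (t : 'I_N) D : envalg eps :=
  \sum_(mu : {ffun {set 'I_N} -> 'I_4} | mu \in pffun_on ord0 (mem D) predT)
    ((\prod_(e in D) form_coef eps (mu e)) *
     (\prod_(e in D)
        \prod_(f in D | (enum_rank e < enum_rank f)%N && crosses e f)
          color_sign K (mu e) (mu f))) *:
    \prod_(p <- rot t (enum 'I_N) | p \in cover D) Qgen eps (mu (pblock D p)).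

End ChordDiagrams.

(* Main.v *)
Require Import Defs.
From HB Require Import structures.
From mathcomp Require Import all_boot all_order all_algebra.
From mathcomp Require Import boolp monalg zify ring.

Set Implicit Arguments.
Unset Strict Implicit.
Unset Printing Implicit Defensive.

Import GRing.Theory.
Local Open Scope ring_scope.

(** The signs of the weight system are removed by a change of algebra. Let
    gamma_1, gamma_2, gamma_3 = gamma_1 gamma_2 be anticommuting 2 x 2 matrices
    of squares 1, 1, -1, put gamma_0 = 1, and let J_m = Q_m (x) gamma_m, a 2 x 2
    matrix over the enveloping algebra. The graded relations become Lie
    relations: J_0 is central, and [J_1, J_2] = J_3, [J_2, J_3] = - eps J_1,
    [J_3, J_1] = - J_2. Along a word read off a labelled chord diagram, the
    matrices gamma multiply to the product, over the crossing pairs, of the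
    signs sigma, times one factor gamma_m^2 per chord of label m
    ([word_sign]). Hence the weight of D, embedded in the matrix algebra, is the
    sum over all labellings of the words in the J_m, without signs, each chord
    of label m contributing beta_m = b^(m) gamma_m^2 ([embed_state_sum]).

    For this ordinary Lie-type weight system, write the word at a given cut as
    P J_m U J_m R, where J_m stands at the ends of the chord a. With
    c = sum_m beta_m J_m^2, which is central,
      2 sum_m beta_m J_m U J_m = 2 c U - sum_m beta_m ad_m (ad_m U),
    and ad_m ad_m is a sum over pairs of letters of U ([word_chord]). A chord
    with both ends in U contributes nothing, by invariance of the tensor
    sum_n beta_n J_n (x) J_n ([ad_invariant]); only the ends in U of the chords
    b_i crossing a remain. The pairs i = i give the terms in D_a and D_{a,i},
    because sum_m beta_m ad_m^2 J_n = 2 eps J_n for n != 0 ([ad_ad_J]). The pairs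
    i != j give the difference of the parallel and the crossed diagrams, by the
    epsilon-delta identity for the cross product ([ad_ad_contract]). That
    identity only concerns nonzero labels, and discarding the label 0 from the
    two new chords produces the four terms with the factor
    c - y = Q_0^2 ([two_chord_nonzero]).

    The computation is local around a, so that it holds at every cut; whether
    the left or the right ends lie in U depends on the cut, but the formula is
    symmetric ([recurrence_rhs_swap]). Since all diagrams on the right of the
    recurrence have fewer chords, and the same recurrence holds at every cut,
    induction on the number of chords gives one polynomial in c and y for all
    cuts ([weight_polynomial]). *)

(** * Identities of the twisted Lie algebra *)

Section LocalIdentities.
Variables (K : fieldType) (eps : K) (A : algType K) (J : 'I_4 -> A).

(** The commutator with the generator [J m]. *)
Definition ad (m : 'I_4) (x : A) : A := J m * x - x * J m.

Definition central (z : A) : Prop := forall x, z * x = x * z.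

(** The Lie relations satisfied by the twisted generators; the indices are those
    of the generators Q. *)
Definition twisted_triple : Prop :=
  [/\ central (J (inord 0)),
      ad (inord 1) (J (inord 2)) = J (inord 3),
      ad (inord 2) (J (inord 3)) = - (eps *: J (inord 1)) &
      ad (inord 3) (J (inord 1)) = - J (inord 2)].

(** The coefficient of a chord of label m: that of the invariant form, times the
    square of the matrix gamma_m. *)
Definition beta (m : 'I_4) : K :=
  form_coef eps m * (if m == 3%N :> nat then -1 else 1).

Lemma adE m x : ad m x = J m * x - x * J m.
Proof. by []. Qed.

Lemma ad_is_linear m : linear (ad m).
Proof.
move=> a x y; rewrite /ad mulrDr mulrDl -scalerAr -scalerAl opprD scalerBr.
by rewrite !addrA; congr (_ + _); rewrite addrAC.
Qed.

HB.instance Definition _ m :=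
  GRing.isLinear.Build K A A *:%R (ad m) (ad_is_linear m).

Lemma adM m x y : ad m (x * y) = ad m x * y + x * ad m y.
Proof. by rewrite /ad mulrBl mulrBr !mulrA addrA subrK. Qed.

Lemma ad1 m : ad m 1 = 0.
Proof. by rewrite /ad mulr1 mul1r subrr. Qed.

Lemma ad_centralM m z x : central z -> ad m (z * x) = z * ad m x.
Proof. by move=> cz; rewrite /ad mulrBr !mulrA (cz (J m)). Qed.

Lemma adC m n : ad m (J n) = - ad n (J m).
Proof. by rewrite /ad opprB. Qed.

Lemma sum_I4 (V : nmodType) (F : 'I_4 -> V) :
  \sum_m F m = F (inord 0) + F (inord 1) + F (inord 2) + F (inord 3).
Proof.
rewrite !big_ord_recl big_ord0 addr0 !addrA.
by congr (F _ + F _ + F _ + F _); apply/val_inj; rewrite /= inordK.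
Qed.

Lemma I4_case (P : 'I_4 -> Prop) :
  P (inord 0) -> P (inord 1) -> P (inord 2) -> P (inord 3) -> forall m, P m.
Proof.
move=> P0 P1 P2 P3 m; rewrite -[m]inord_val.
by case: m => [[|[|[|[|]]]] ?].
Qed.

Hypothesis eps2 : eps * eps = 1.
Hypothesis JJ : twisted_triple.

Lemma ad_table :
  ((ad (inord 1) (J (inord 2)) = J (inord 3)) *
  (ad (inord 2) (J (inord 1)) = - J (inord 3)) *
  (ad (inord 2) (J (inord 3)) = - (eps *: J (inord 1))) *
  (ad (inord 3) (J (inord 2)) = eps *: J (inord 1)) *
  (ad (inord 3) (J (inord 1)) = - J (inord 2)) *
  (ad (inord 1) (J (inord 3)) = J (inord 2)) *
  (forall m, ad m (J (inord 0)) = 0) *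
  (forall x, ad (inord 0) x = 0) *
  (forall m, ad m (J m) = 0))%type.
Proof.
have [c0 j12 j23 j31] := JJ.
by do !split; rewrite ?[ad (inord 2) (J (inord 1))]adC
  ?[ad (inord 3) (J (inord 2))]adC ?[ad (inord 1) (J (inord 3))]adC
  ?j12 ?j23 ?j31 ?opprK // => *; rewrite /ad ?c0 subrr.
Qed.

Lemma betaE : ((beta (inord 0) = 1) * (beta (inord 1) = eps) *
               (beta (inord 2) = 1) * (beta (inord 3) = -1))%type.
Proof. by rewrite /beta /form_coef !inordK //= !mulr1 mul1r. Qed.

Lemma inord4_eqE : ((@inord 3 1 == inord 0) = false) * ((@inord 3 2 == inord 0) = false) *
  ((@inord 3 3 == inord 0) = false) * ((@inord 3 1 == inord 2) = false) *
  ((@inord 3 2 == inord 1) = false) * ((@inord 3 1 == inord 3) = false) *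
  ((@inord 3 3 == inord 1) = false) * ((@inord 3 2 == inord 3) = false) *
  ((@inord 3 3 == inord 2) = false) * ((@inord 3 0 == inord 1) = false) *
  ((@inord 3 0 == inord 2) = false) * ((@inord 3 0 == inord 3) = false).
Proof. by do !split; apply/eqP => /(congr1 val); rewrite /= !inordK. Qed.

Lemma inord0E : @inord 3 0 = ord0.
Proof. by apply/val_inj; rewrite /= inordK. Qed.

Lemma beta_sqr m : beta m * beta m = 1.
Proof. by elim/I4_case: m; rewrite betaE ?mulr1 ?mulrN1 ?opprK ?eps2. Qed.

Definition bilin (V : lmodType K) (B : A -> A -> V) : Prop :=
  (forall a x x' y, B (a *: x + x') y = a *: B x y + B x' y) /\
  (forall a x y y', B x (a *: y + y') = a *: B x y + B x y').

Section Bilin.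
Variables (V : lmodType K) (B : A -> A -> V) (BB : bilin B).

Lemma bilin0l y : B 0 y = 0.
Proof.
have := BB.1 1 0 0 y; rewrite !scale1r addr0 => /eqP.
by rewrite -subr_eq0 opprD addrA subrr sub0r oppr_eq0 => /eqP.
Qed.

Lemma bilin0r x : B x 0 = 0.
Proof.
have := BB.2 1 x 0 0; rewrite !scale1r addr0 => /eqP.
by rewrite -subr_eq0 opprD addrA subrr sub0r oppr_eq0 => /eqP.
Qed.

Lemma bilinZl a x y : B (a *: x) y = a *: B x y.
Proof. by rewrite -[a *: x]addr0 BB.1 bilin0l addr0. Qed.
Lemma bilinZr a x y : B x (a *: y) = a *: B x y.
Proof. by rewrite -[a *: y]addr0 BB.2 bilin0r addr0. Qed.
Lemma bilinNl x y : B (- x) y = - B x y.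
Proof. by rewrite -!scaleN1r bilinZl. Qed.
Lemma bilinNr x y : B x (- y) = - B x y.
Proof. by rewrite -!scaleN1r bilinZr. Qed.
Definition bilinE := (bilin0l, bilin0r, bilinNl, bilinNr, bilinZl, bilinZr).

(** Invariance of the tensor sum_n beta_n J_n (x) J_n under [ad m]. *)
Lemma ad_invariant m :
  \sum_n beta n *: (B (ad m (J n)) (J n) + B (J n) (ad m (J n))) = 0.
Proof.
elim/I4_case: m; rewrite sum_I4 !ad_table !betaE !bilinE.
- by rewrite !(addr0, scaler0).
- by rewrite !(addr0, scaler0, add0r) scale1r scaleN1r addrC [X in - X]addrC addNr.
- rewrite !(addr0, scaler0, add0r) !scaleN1r -!opprD -scalerDr scalerN.
  by rewrite opprK [B (J (inord 3)) _ + _]addrC addNr.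
- rewrite !(addr0, scaler0, add0r) scale1r -!opprD -scalerDr scalerN.
  by rewrite [B (J (inord 2)) _ + _]addrC addNr.
Qed.

(** The epsilon-delta identity of the three-dimensional cross product. As
    beta_n is its own inverse, it stands here for the dual coefficient. *)
Lemma ad_ad_contract n n' : n != ord0 -> n' != ord0 ->
  \sum_m beta m *: B (ad m (J n)) (ad m (J n')) =
  eps *: (B (J n') (J n) -
    (if n == n' then beta n *: \sum_(l | l != ord0) beta l *: B (J l) (J l)
     else 0)).
Proof.
have S : \sum_(l | l != ord0) beta l *: B (J l) (J l) =
  eps *: B (J (inord 1)) (J (inord 1)) + B (J (inord 2)) (J (inord 2))
   - B (J (inord 3)) (J (inord 3)).
  rewrite big_mkcond sum_I4 -!inord0E !inord4_eqE eqxx /= !betaE add0r.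
  by rewrite scale1r scaleN1r.
rewrite S -inord0E.
set B1 := B (J (inord 1)) (J (inord 1)).
set B2 := B (J (inord 2)) (J (inord 2)).
set B3 := B (J (inord 3)) (J (inord 3)).
elim/I4_case: n; elim/I4_case: n'; rewrite ?eqxx // => _ _;
  rewrite sum_I4 !ad_table !betaE !bilinE ?inord4_eqE ?eqxx -/B1 -/B2 -/B3.
all: rewrite !(addr0, scaler0, add0r, scaleN1r, scale1r, subr0, sub0r, opprK, scalerN) //.
all: rewrite ?(scalerBr, scalerDr, scalerN, scalerA) ?eps2 ?scale1r //.
- by rewrite mul1r opprB addrCA opprD addNKr.
- by rewrite opprB addrCA [B1 + _]addrC opprD addNKr.
- by rewrite [RHS]addrC subrK addrC.
Qed.

End Bilin.

(** The Casimir element acts by 2 eps on the span of J_1, J_2, J_3. *)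
Lemma ad_ad_J n : \sum_m beta m *: ad m (ad m (J n)) =
  if n == ord0 then 0 else (eps *: J n) *+ 2.
Proof.
rewrite -inord0E; elim/I4_case: n; rewrite ?eqxx ?inord4_eqE sum_I4 !betaE.
- by rewrite !ad_table !linear0 ?scaler0 !addr0.
- rewrite !ad_table !(linearN, linearZ, linear0) /= !ad_table.
  by rewrite !(scaler0, addr0, add0r, scale1r, scaleN1r, opprK, scalerN, scaleNr, mulrN1, mul1r, mulr2n, scalerA).
- rewrite !ad_table !(linearN, linearZ, linear0) /= !ad_table.
  by rewrite !(scaler0, addr0, add0r, scale1r, scaleN1r, opprK, scalerN, scaleNr, mulrN1, mul1r, mulr2n, scalerA).
- rewrite !ad_table !(linearN, linearZ, linear0) /= !ad_table.
  by rewrite !(scaler0, addr0, add0r, scale1r, scaleN1r, opprK, scalerN, scaleNr, mulrN1, mul1r, mulr2n, scalerA).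
Qed.

End LocalIdentities.

(** * Sums over the labellings of the chords *)

Section StateSums.
Variables (K : fieldType) (A : algType K) (I : finType).
Variables (beta : 'I_4 -> K) (J : 'I_4 -> A).
Implicit Types (f : I -> A) (F G : (I -> A) -> A) (D : {set {set I}}) (e : {set I}).
Implicit Types (mu : {ffun {set I} -> 'I_4}).

(** A word is given by a function f from the marks to the algebra. [upd] and
    [setv] change its value at one mark, or at all marks of a set. *)
Definition upd f (p : I) (x : A) : I -> A := fun q => if q == p then x else f q.

Definition setv f e (x : A) : I -> A := fun q => if q \in e then x else f q.

(** The word in which every end of a chord of label n carries [J n]. *)
Definition fill D mu f : I -> A :=
  fun p => if p \in cover D then J (mu (pblock D p)) else f p.

(** The sum over the labellings of D of the values of F, any function of the
    word; marks off the chords of D keep their value in f. Labellings are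
    extended by 0 outside D. *)
Definition state_sum D F f : A :=
  \sum_(mu : {ffun {set I} -> 'I_4} | mu \in pffun_on ord0 (mem D) predT)
    (\prod_(e in D) beta (mu e)) *: F (fill D mu f).

(** Linearity of F in the letter at p, over the whole centre of the algebra, so
    that a central letter can be taken out. *)
Definition lin_at (p : I) F : Prop :=
  forall z f x y, central z ->
    F (upd f p (z * x + y)) = z * F (upd f p x) + F (upd f p y).

Lemma upd_same f p x y : upd (upd f p x) p y = upd f p y.
Proof. by apply/funext => q; rewrite /upd; case: eqP. Qed.

Lemma updC f p q x y : p != q -> upd (upd f p x) q y = upd (upd f q y) p x.
Proof.
move=> pq; apply/funext => u; rewrite /upd; case: (u =P q) => [->|//].
by rewrite eq_sym (negPf pq).
Qed.

Lemma upd_id f p : upd f p (f p) = f.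
Proof. by apply/funext => q; rewrite /upd; case: eqP => [->|]. Qed.

Lemma updE f p x : upd f p x p = x.
Proof. by rewrite /upd eqxx. Qed.

Lemma upd_neq f p q x : q != p -> upd f p x q = f q.
Proof. by rewrite /upd => /negPf ->. Qed.

Lemma setv2 f p q x : p != q -> setv f [set p; q] x = upd (upd f p x) q x.
Proof.
move=> pq; apply/funext => u; rewrite /setv /upd !inE.
by case: (u == p); case: (u == q). 
Qed.

Lemma central_alg (a : K) : central (a%:A : A).
Proof. by move=> x; rewrite mulr_algl mulr_algr. Qed.

Section LinAt.
Variables (p : I) (F : (I -> A) -> A).
Hypothesis linF : lin_at p F.

Lemma lin_at0 f : F (upd f p 0) = 0.
Proof.
have := linF f 0 0 (central_alg 1); rewrite !scale1r !mul1r addr0 => /eqP.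
by rewrite -subr_eq0 opprD addrA subrr sub0r oppr_eq0 => /eqP.
Qed.

Lemma lin_atM z f x : central z -> F (upd f p (z * x)) = z * F (upd f p x).
Proof. by move=> cz; rewrite -[z * x]addr0 linF // lin_at0 addr0. Qed.

Lemma lin_atZ a f x : F (upd f p (a *: x)) = a *: F (upd f p x).
Proof. by rewrite -mulr_algl (lin_atM _ _ (central_alg a)) mulr_algl. Qed.

Lemma lin_atD f x y : F (upd f p (x + y)) = F (upd f p x) + F (upd f p y).
Proof. by have := linF f x y (central_alg 1); rewrite scale1r !mul1r. Qed.

Lemma lin_at_linear f : linear (fun x => F (upd f p x)).
Proof. by move=> a x y; rewrite lin_atD lin_atZ. Qed.

Lemma lin_at_sum (T : finType) (P : pred T) (g : T -> A) f :
  F (upd f p (\sum_(i | P i) g i)) = \sum_(i | P i) F (upd f p (g i)).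
Proof.
apply: (big_morph (fun x => F (upd f p x))) => [x y|]; first exact: lin_atD.
exact: lin_at0.
Qed.

End LinAt.

Lemma fill_upd D mu f p x : p \notin cover D ->
  fill D mu (upd f p x) = upd (fill D mu f) p x.
Proof.
move=> pD; apply/funext => q; rewrite /fill /upd.
by case: (q =P p) => // ->; rewrite (negPf pD).
Qed.

Lemma fill_setv D mu f e x : [disjoint e & cover D] ->
  fill D mu (setv f e x) = setv (fill D mu f) e x.
Proof.
move=> dis; apply/funext => q; rewrite /fill /setv.
by case: ifP => // qD; rewrite (disjointFl dis qD).
Qed.

Lemma fill_notin D mu f p : p \notin cover D -> fill D mu f p = f p.
Proof. by rewrite /fill => /negPf ->. Qed.

Lemma state_sum_lin_at D F p : p \notin cover D -> lin_at p F ->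
  lin_at p (state_sum D F).
Proof.
move=> pD lF z f x y cz; rewrite /state_sum mulr_sumr -big_split.
apply: eq_bigr => mu _ /=; rewrite !fill_upd // lF // scalerDr scalerAr //.
Qed.

Lemma state_sumD D F G f :
  state_sum D (fun g => F g + G g) f = state_sum D F f + state_sum D G f.
Proof. by rewrite -big_split; apply: eq_bigr => mu _; rewrite scalerDr. Qed.

Lemma state_sumZ D F a f :
  state_sum D (fun g => a *: F g) f = a *: state_sum D F f.
Proof.
by rewrite scaler_sumr; apply: eq_bigr => mu _; rewrite !scalerA mulrC.
Qed.

Lemma state_sum_sum D (T : Type) (s : seq T) (P : pred T) (F : T -> (I -> A) -> A) f :
  state_sum D (fun g => \sum_(i <- s | P i) F i g) f
  = \sum_(i <- s | P i) state_sum D (F i) f.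
Proof.
by rewrite exchange_big; apply: eq_bigr => mu _; rewrite scaler_sumr.
Qed.

Lemma state_sum_mull D F z f :
  state_sum D (fun g => z * F g) f = z * state_sum D F f.
Proof. by rewrite mulr_sumr; apply: eq_bigr => mu _; rewrite scalerAr. Qed.

Lemma state_sum0 F f : state_sum set0 F f = F f.
Proof.
rewrite /state_sum (big_pred1 [ffun => ord0]) => [|mu].
  rewrite big_set0 scale1r; congr F; apply/funext => p.
  by rewrite /fill /cover big_set0 inE.
rewrite /=; apply/pffun_onP/eqP => [[/supportP s0 _]|->].
  by apply/ffunP => e; rewrite ffunE s0 ?inE.
by split=> [|//]; apply/supportP => e _; rewrite ffunE.
Qed.

Lemma disjoint_cover D e : e \notin D -> trivIset (e |: D) -> [disjoint e & cover D].
Proof.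
move=> eD tI; rewrite disjoints_subset; apply/subsetP => p pe; rewrite inE.
apply/bigcupP => -[B BD pB].
have /(trivIsetP tI) : e != B by apply: contraNneq eD => ->.
by rewrite !inE eqxx BD orbT => /(_ isT isT)/disjointFr/(_ pe); rewrite pB.
Qed.

Lemma fill_setU1 D mu f e : e \notin D -> trivIset (e |: D) ->
  fill (e |: D) mu f = setv (fill D mu f) e (J (mu e)).
Proof.
move=> eD tI; have dis := disjoint_cover eD tI.
have tD : trivIset D by apply: trivIsetS tI; apply: subsetUr.
apply/funext => p; rewrite /fill /setv /cover big_setU1 // inE.
case: (boolP (p \in e)) => pe /=; first by rewrite (def_pblock tI _ pe) ?setU11.
case: bigcupP => // -[B BD pB].
by rewrite (def_pblock tI _ pB) ?setU1r // (def_pblock tD _ pB).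
Qed.

Lemma mem_pffun_labels D mu :
  (mu \in pffun_on ord0 (mem D) predT)
  = [forall e, (e \notin D) ==> (mu e == ord0)].
Proof.
apply/pffun_onP/forallP => [[/supportP s0 _] e|m0].
  by apply/implyP => eD; rewrite s0.
split=> [|//]; apply/supportP => e eD; apply/eqP.
by have /implyP := m0 e; apply.
Qed.

(** Summing first over the label of one chord. *)
Lemma state_sum_setU1 D e F f : e \notin D -> trivIset (e |: D) -> e != set0 ->
  state_sum (e |: D) F f
  = \sum_n beta n *: state_sum D F (setv f e (J n)).
Proof.
move=> eD tI e0.
have tD : trivIset D by apply: trivIsetS tI; apply: subsetUr.
rewrite /state_sum (partition_big (fun mu : {ffun _} => mu e) predT) //=.
apply: eq_bigr => n _; rewrite scaler_sumr.
rewrite (reindex_onto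
  (fun mu : {ffun _} => [ffun x => if x == e then n else mu x])
  (fun mu : {ffun _} => [ffun x => if x == e then ord0 else mu x])) /=; last first.
  move=> mu /andP[_ /eqP <-]; apply/ffunP => x; rewrite !ffunE.
  by case: eqP => // ->.
apply: eq_big => [mu|mu]; rewrite ?ffunE ?eqxx ?andbT.
  rewrite !mem_pffun_labels; apply/andP/forallP => [[/forallP m0 /eqP hm] x|m0].
    apply/implyP => xD; move/(_ x): m0; rewrite ffunE !inE negb_or xD andbT.
    case: eqP => [->|_ //] _.
    by rewrite -hm !ffunE eqxx.
  split.
    apply/forallP => x; rewrite !inE negb_or ffunE; apply/implyP => /andP[/negPf-> xD].
    by have /implyP := m0 x; apply.
  apply/eqP/ffunP => x; rewrite !ffunE; case: eqP => // ->.
  by have /implyP/(_ eD)/eqP := m0 e.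
move=> _; rewrite big_setU1 //= ffunE eqxx -scalerA; congr (_ *: (_ *: F _)).
  by apply: eq_bigr => x xD; rewrite ffunE; case: eqP => // xe; rewrite xe (negPf eD) in xD.
rewrite fill_setU1 // ffunE eqxx fill_setv ?disjoint_cover //; congr setv.
apply/funext => p; rewrite /fill; case: ifP => // pD; rewrite ffunE.
by case: eqP => // pe; rewrite -pe pblock_mem in eD.
Qed.

End StateSums.

(** * Contraction of two chords *)

Section Contraction.
Variables (K : fieldType) (eps : K) (A : algType K) (J : 'I_4 -> A).
Hypothesis eps2 : eps * eps = 1.
Hypothesis JJ : twisted_triple eps J.
Local Notation beta := (beta eps).
Local Notation ad := (ad J).
Local Notation Z := (J ord0).

Definition central_linear (h : A -> A) : Prop :=
  forall z x y, central z -> h (z * x + y) = z * h x + h y.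

Definition tetralinear (G : A -> A -> A -> A -> A) : Prop :=
  [/\ forall x2 x3 x4, central_linear (fun x => G x x2 x3 x4),
      forall x1 x3 x4, central_linear (fun x => G x1 x x3 x4),
      forall x1 x2 x4, central_linear (fun x => G x1 x2 x x4) &
      forall x1 x2 x3, central_linear (fun x => G x1 x2 x3 x)].

Lemma central_linear_linear h : central_linear h -> linear h.
Proof. by move=> lh a x y; have := lh a%:A x y (central_alg a); rewrite !mulr_algl. Qed.

Lemma central_linear1 h z : central_linear h -> central z -> h z = z * h 1.
Proof.
move=> lh cz; have h0 : h 0 = 0.
  have := lh _ 0 0 (central_alg 1); rewrite scale1r !mul1r addr0 => /eqP.
  by rewrite -subr_eq0 opprD addrA subrr sub0r oppr_eq0 => /eqP.
by have := lh z 1 0 cz; rewrite mulr1 h0 !addr0.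
Qed.

Lemma beta0 : beta ord0 = 1.
Proof. by rewrite -inord0E betaE. Qed.

Lemma central_J0 : central Z.
Proof. by rewrite -inord0E; case: JJ. Qed.

Lemma ad_J0 m : ad m Z = 0.
Proof. by rewrite /ad -central_J0 subrr. Qed.

Lemma sum_nonzero (V : zmodType) (F : 'I_4 -> V) :
  \sum_n F n = F ord0 + \sum_(n | n != ord0) F n.
Proof. by rewrite (bigD1 ord0). Qed.

(** Removing the label 0 from the labellings of two chords. Here z is the square
    of J_0; P and Q are the contributions of each chord alone, and g that of
    neither. *)
Lemma two_chord_nonzero (z g : A) (H : 'I_4 -> 'I_4 -> A) (P Q : 'I_4 -> A) :
  (forall n, H ord0 n = z * Q n) -> (forall n, H n ord0 = z * P n) ->
  P ord0 = z * g -> Q ord0 = z * g ->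
  \sum_n \sum_n' (beta n * beta n') *: H n n'
    - z * (\sum_n beta n *: P n + \sum_n beta n *: Q n)
  = \sum_(n | n != ord0) \sum_(n' | n' != ord0) (beta n * beta n') *: H n n'
    - z * (z * g).
Proof.
move=> H0l H0r P0 Q0; rewrite !sum_nonzero beta0 !scale1r P0 Q0 mul1r scale1r.
have -> : \sum_(n' | n' != ord0) (1 * beta n') *: H ord0 n'
        = z * \sum_(n' | n' != ord0) beta n' *: Q n'.
  by rewrite mulr_sumr; apply: eq_bigr => n _; rewrite mul1r H0l scalerAr.
set S := \sum_(n | _) \sum_(n' | n' != ord0) _.
have -> : \sum_(n | n != ord0) \sum_n' (beta n * beta n') *: H n n'
        = \sum_(n | n != ord0) beta n *: (z * P n) + S.
  rewrite -big_split; apply: eq_bigr => n _.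
  by rewrite sum_nonzero beta0 mulr1 H0r.
rewrite H0l Q0.
have -> : \sum_(n | n != ord0) beta n *: (z * P n)
        = z * \sum_(n | n != ord0) beta n *: P n.
  by rewrite mulr_sumr; apply: eq_bigr => n _; rewrite scalerAr.
set SQ := \sum_(n | _) _ *: Q n; set SP := \sum_(n | _) _ *: P n.
rewrite !mulrDr.
set w := z * (z * g); set u := z * SQ; set v := z * SP.
apply/eqP; rewrite subr_eq -[w + v + _]addrA [X in _ == X]addrA subrK.
by rewrite [X in _ == X]addrA [S + v]addrC addrC.
Qed.

(** G is the contribution of the letters at l_i, r_i, l_j, r_j. Acting on the ends
    l_i and l_j of two chords gives the crossed minus the parallel pairing of the
    four marks, both restricted to nonzero labels by the corrections in Z ^+ 2. *)
Lemma contract_crossing_pair G : tetralinear G ->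
  \sum_m beta m *: (\sum_n \sum_n' (beta n * beta n') *:
      G (ad m (J n)) (J n) (ad m (J n')) (J n'))
  = eps *: (
    (\sum_n \sum_n' (beta n * beta n') *: G (J n) (J n') (J n') (J n)
     - Z ^+ 2 * (\sum_n beta n *: G (J n) 1 1 (J n)
                + \sum_n beta n *: G 1 (J n) (J n) 1))
    - (\sum_n \sum_n' (beta n * beta n') *: G (J n) (J n') (J n) (J n')
     - Z ^+ 2 * (\sum_n beta n *: G (J n) 1 (J n) 1
                + \sum_n beta n *: G 1 (J n) 1 (J n)))).
Proof.
case=> l1 l2 l3 l4; have cZ := central_J0.
have Z1 x2 x3 x4 : G Z x2 x3 x4 = Z * G 1 x2 x3 x4.
  exact: (central_linear1 (l1 x2 x3 x4)).
have Z2 x1 x3 x4 : G x1 Z x3 x4 = Z * G x1 1 x3 x4.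
  exact: (central_linear1 (l2 x1 x3 x4)).
have Z3 x1 x2 x4 : G x1 x2 Z x4 = Z * G x1 x2 1 x4.
  exact: (central_linear1 (l3 x1 x2 x4)).
have Z4 x1 x2 x3 : G x1 x2 x3 Z = Z * G x1 x2 x3 1.
  exact: (central_linear1 (l4 x1 x2 x3)).
have ZZ x : Z * (Z * x) = Z ^+ 2 * x by rewrite mulrA.
have B24 x2 x4 : bilin (fun x y => G x x2 y x4).
  split=> [a x x' y|a x y y'].
    exact: (central_linear_linear (l1 _ _ _)).
  exact: (central_linear_linear (l3 _ _ _)).
rewrite (@two_chord_nonzero _ (G 1 1 1 1)) => [|n|n||]; last first.
- by rewrite Z2 Z3 ZZ.
- by rewrite Z1 Z4 ZZ.
- by rewrite Z2 Z3 ZZ.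
- by rewrite Z1 Z4 ZZ.
rewrite (@two_chord_nonzero _ (G 1 1 1 1)) => [|n|n||]; last first.
- by rewrite Z2 Z4 ZZ.
- by rewrite Z1 Z3 ZZ.
- by rewrite Z2 Z4 ZZ.
- by rewrite Z1 Z3 ZZ.
(* The terms with both labels 0 are the same on both sides and cancel. *)
rewrite opprB addrA subrK.
under eq_bigr => m _ do rewrite scaler_sumr.
rewrite exchange_big sum_nonzero /= big1 ?add0r => [|m _]; last first.
  rewrite big1 ?scaler0 // => n _.
  by rewrite ad_J0 (bilin0l (B24 _ _)) scaler0.
under eq_bigr => n _.
  under eq_bigr => m _ do rewrite scaler_sumr.
  rewrite exchange_big sum_nonzero /= big1 ?add0r => [|m _]; last first.
    by rewrite ad_J0 (bilin0r (B24 _ _)) !scaler0.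
  over.
rewrite [X in _ *: (X - _)]exchange_big [X in _ *: (_ - X)]exchange_big /=.
rewrite -sumrB scaler_sumr; apply: eq_bigr => n n0.
transitivity (\sum_(n' | n' != ord0) (beta n * beta n') *:
    (eps *: (G (J n') (J n) (J n) (J n') -
       (if n == n' then
          beta n *: \sum_(l | l != ord0) beta l *: G (J l) (J n) (J l) (J n')
        else 0)))).
  apply: eq_bigr => n' n'0; rewrite -(ad_ad_contract eps2 JJ (B24 _ _) n0 n'0).
  by rewrite scaler_sumr; apply: eq_bigr => m _; rewrite !scalerA mulrC.
transitivity (eps *: (
    \sum_(n' | n' != ord0) (beta n * beta n') *: G (J n') (J n) (J n) (J n')
  - \sum_(n' | n' != ord0) (beta n * beta n') *:
       (if n == n' then
          beta n *: \sum_(l | l != ord0) beta l *: G (J l) (J n) (J l) (J n')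
        else 0))).
  rewrite -sumrB scaler_sumr; apply: eq_bigr => n' _.
  by rewrite scalerA [_ * eps]mulrC !scalerBr !scalerA.
congr (eps *: _); congr (_ - _).
  by apply: eq_bigr => n' _; rewrite mulrC.
rewrite (bigD1 n) //= eqxx [X in _ + X]big1 ?addr0 => [|n' /andP[_ /negPf n'n]]; last first.
  by rewrite eq_sym n'n scaler0.
rewrite (beta_sqr eps2) scale1r scaler_sumr.
by apply: eq_bigr => l _; rewrite scalerA mulrC.
Qed.

End Contraction.

(** * Words and derivations *)

Section Words.
Variables (K : fieldType) (eps : K) (A : algType K) (I : finType).
Variables (J : 'I_4 -> A).
Implicit Types (f : I -> A) (F G : (I -> A) -> A) (D : {set {set I}}) (e : {set I}).
Local Notation beta := (beta eps).
Local Notation ad := (ad J).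
Local Notation state_sum := (state_sum beta J).

Definition word (s : seq I) f : A := \prod_(p <- s) f p.

(** The word with its letter at p replaced by its commutator with [J m]. *)
Definition drv m (p : I) f : I -> A := upd f p (ad m (f p)).

Lemma eq_word s f g : {in s, f =1 g} -> word s f = word s g.
Proof. exact: eq_big_seq. Qed.

Lemma word_lin_at s p : uniq s -> p \in s -> lin_at p (word s).
Proof.
move=> us ps; case/splitPr: ps us => s1 s2.
rewrite cat_uniq /= negb_or => /and4P[_ /andP[ps1 _] ps2 _] z f x y cz.
have W v : word (s1 ++ p :: s2) (upd f p v) = word s1 f * (v * word s2 f).
  rewrite /word big_cat big_cons updE; congr (_ * (_ * _)); apply: eq_big_seq => q qs.
    by rewrite upd_neq //; apply: contraNneq ps1 => <-.
  by rewrite upd_neq //; apply: contraNneq ps2 => <-.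
by rewrite !W mulrDl mulrDr -!mulrA [word s1 f * (z * _)]mulrA -cz !mulrA.
Qed.

Lemma ad_word m u f : uniq u ->
  ad m (word u f) = \sum_(q <- u) word u (drv m q f).
Proof.
rewrite /word; elim: u => [|q u IH] /=; first by rewrite !big_nil ad1.
case/andP=> qu uu; rewrite !big_cons adM IH // /drv updE; congr (_ + _).
  congr (_ * _); apply: eq_big_seq => p pu; rewrite /drv upd_neq //.
  by apply: contraNneq qu => <-.
rewrite mulr_sumr; apply: eq_big_seq => p pu; rewrite big_cons /drv upd_neq //.
by apply: contraNneq qu => ->.
Qed.

Lemma ad_ad_word m u f : uniq u ->
  ad m (ad m (word u f)) = \sum_(p <- u) \sum_(q <- u) word u (drv m q (drv m p f)).
Proof.
move=> uu; rewrite ad_word // linear_sum; apply: eq_bigr => p _.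
exact: ad_word.
Qed.

Definition casimir_elt : A := \sum_m beta m *: J m ^+ 2.

Lemma word_setv2 s1 x u y s2 f v : uniq (s1 ++ x :: u ++ y :: s2) ->
  word (s1 ++ x :: u ++ y :: s2) (setv f [set x; y] v)
  = word s1 f * (v * (word u f * (v * word s2 f))).
Proof.
rewrite cat_uniq /= mem_cat cat_uniq /= !inE !negb_or.
case/and3P=> _ /andP[xs1 /hasPn hs1] /and3P[/and3P[xu _ xs2] _ /andP[/andP[yu _] /andP[ys2 _]]].
have ys1 : y \notin s1 by apply: hs1; rewrite mem_cat inE eqxx orbT.
have out r : x \notin r -> y \notin r -> word r (setv f [set x; y] v) = word r f.
  move=> xr yr; apply: eq_word => q qr; rewrite /setv !inE.
  by case: eqP => [qx|_]; [rewrite -qx qr in xr|case: eqP => // qy; rewrite -qy qr in yr].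
rewrite {1}/word big_cat big_cons big_cat big_cons -!/(word _ _) !out //.
by rewrite /setv !inE !eqxx orbT.
Qed.

(** The words around a chord with ends x and y, summed over its label: with
    U = word u f, this is the identity
    2 J U J = J^2 U + U J^2 - [J, [J, U]], contracted with beta. *)
Lemma word_chord s1 x u y s2 f : uniq (s1 ++ x :: u ++ y :: s2) ->
  central casimir_elt -> f x = 1 -> f y = 1 ->
  let s := s1 ++ x :: u ++ y :: s2 in
  (\sum_m beta m *: word s (setv f [set x; y] (J m))) *+ 2
  = (casimir_elt * word s f) *+ 2
    - \sum_m beta m *: \sum_(p <- u) \sum_(q <- u) word s (drv m q (drv m p f)).
Proof.
move=> us cc fx fy s; rewrite -/s in us *.
have ws g : word s g = word s1 g * (g x * (word u g * (g y * word s2 g))).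
  by rewrite /word big_cat big_cons big_cat big_cons.
move: (us); rewrite cat_uniq /= mem_cat negb_or cat_uniq /= !inE.
rewrite !negb_or => /and3P[us1 /andP[xs1]].
move/hasPn => hs1 /and3P[/and3P[xu xy xs2] uu /and3P[/andP[yu /hasPn hu] ys2 us2]].
have ys1 : y \notin s1 by apply: hs1; rewrite mem_cat inE eqxx orbT.
have us1' p : p \in u -> p \notin s1 by move=> pu; apply: hs1; rewrite mem_cat pu.
have us2' p : p \in u -> p \notin s2.
  by move=> pu; apply/negP => ps2; have := hu p ps2; rewrite /= pu.
have W v := word_setv2 f v us.
have W1 : word s f = word s1 f * (word u f * word s2 f) by rewrite ws fx fy !mul1r.
have W2 m : \sum_(p <- u) \sum_(q <- u) word s (drv m q (drv m p f))
    = word s1 f * (ad m (ad m (word u f)) * word s2 f).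
  rewrite ad_ad_word // mulr_suml mulr_sumr; apply: eq_big_seq => p pu.
  rewrite mulr_suml mulr_sumr; apply: eq_big_seq => q qu.
  have out r : p \notin r -> q \notin r -> word r (drv m q (drv m p f)) = word r f.
    move=> pr qr; apply: eq_word => t tr.
    by rewrite /drv !upd_neq //; apply: contraTneq tr => ->.
  have neq t : t \notin u -> drv m q (drv m p f) t = f t.
    by move=> tu; rewrite /drv !upd_neq //; apply: contraNneq tu => ->.
  by rewrite ws (out s1) ?(out s2) ?us1' ?us2' // !neq // fx fy !mul1r.
under eq_bigr => m _ do rewrite W.
under [X in _ - X]eq_bigr => m _ do rewrite W2.
have -> : (casimir_elt * word s f) *+ 2
    = word s1 f * (casimir_elt * (word u f * word s2 f))
      + word s1 f * (word u f * (casimir_elt * word s2 f)).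
  by rewrite mulr2n W1 [casimir_elt * (_ * _)]mulrA cc -!mulrA [casimir_elt * word s2 f]cc
     [casimir_elt * (_ * _)]cc -!mulrA.
rewrite /casimir_elt !mulr_suml !mulr_sumr -sumrMnl -big_split -sumrB.
apply: eq_bigr => m _ /=; rewrite -!(scalerAl, scalerAr) scalerMnr -scalerDr -scalerBr.
congr (_ *: _); rewrite !adE; set P := word s1 f; set U := word u f.
set Q := word s2 f.
rewrite !(mulrBl, mulrBr) expr2 !mulrA mulr2n.
set X := P * J m * U * J m * Q; rewrite !opprB [_ + P * U * _ * _ * _]addrC addrACA.
by rewrite ![_ + (X - _)]addrC !subrK.
Qed.

End Words.

(** * The recurrence without signs *)

Section Recurrence.
Variables (K : fieldType) (eps : K) (A : algType K) (I : finType).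
Variables (J : 'I_4 -> A) (s : seq I).
Implicit Types (f : I -> A) (F G : (I -> A) -> A) (D : {set {set I}}) (e : {set I}).
Hypothesis eps2 : eps * eps = 1.
Hypothesis JJ : twisted_triple eps J.
Hypothesis casimir_central : central (casimir_elt eps J).
Hypothesis uniq_s : uniq s.
Hypothesis all_s : forall p, p \in s.
Local Notation beta := (beta eps).
Local Notation ad := (ad J).
Local Notation state_sum := (state_sum beta J).
Local Notation drv := (drv J).
Local Notation c := (casimir_elt eps J).
Local Notation W := (@word K A I s).

Definition unit_word : I -> A := fun => 1.
Local Notation f1 := unit_word.

(** The weight of a set of chords, every mark off the chords contributing 1. *)
Definition twisted_weight D : A := state_sum D W f1.

Lemma lin_word p : lin_at p W.
Proof. exact: word_lin_at. Qed.

Lemma drv_upd m p q f x : p != q -> drv m p (upd f q x) = upd (drv m p f) q x.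
Proof. by move=> pq; rewrite /drv upd_neq // updC 1?eq_sym. Qed.

Lemma drv_upd_same m p f x : drv m p (upd f p x) = upd f p (ad m x).
Proof. by rewrite /drv updE upd_same. Qed.

Lemma drvC m p q f : drv m p (drv m q f) = drv m q (drv m p f).
Proof.
have [->//|pq] := eqVneq p q.
by rewrite {2}/drv drv_upd // /drv !upd_neq // eq_sym.
Qed.

Lemma lin_drv m p q F : lin_at p F -> lin_at p (fun g => F (drv m q g)).
Proof.
move=> lF z f x y cz; have [<-|qp] := eqVneq p q.
  by rewrite !drv_upd_same (linearD (ad m)) /= ad_centralM // lF.
by rewrite eq_sym in qp; rewrite !drv_upd // lF.
Qed.

Lemma state_sum_drv D F m p f : p \notin cover D ->
  state_sum D (fun g => F (drv m p g)) f = state_sum D F (drv m p f).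
Proof.
move=> pD; apply: eq_bigr => mu _; congr (_ *: F _).
by rewrite /drv fill_upd // fill_notin.
Qed.

Lemma bilin_upd2 F p q f : p != q -> lin_at p F -> lin_at q F ->
  bilin (fun x y => F (upd (upd f p x) q y)).
Proof.
move=> pq lp lq; split=> [a x x' y|a x y y'].
  by rewrite ![upd (upd f p _) q _]updC // (lin_at_linear lp).
exact: (lin_at_linear lq).
Qed.

Lemma notin_cover_setD1 D e p : trivIset D -> e \in D -> p \in e ->
  p \notin cover (D :\ e).
Proof.
move=> tD eD pe; apply/bigcupP => -[B]; rewrite !inE => /andP[Be BD] pB.
by move: Be; rewrite -(def_pblock tD BD pB) (def_pblock tD eD pe) eqxx.
Qed.

Lemma chord_pair_marks D e e' p q : trivIset D -> e \in D -> e' \in D -> e != e' ->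
  p \in e -> q \in e' ->
  [/\ p != q, p \notin cover (D :\ e :\ e') & q \notin cover (D :\ e :\ e')].
Proof.
move=> tD eD e'D ee' pe qe'.
have tD' : trivIset (D :\ e) by apply: trivIsetS tD; apply: subsetDl.
have e'D' : e' \in D :\ e by rewrite in_setD1 eq_sym ee'.
split; last exact: (notin_cover_setD1 tD' e'D').
  apply: contraNneq ee' => pq; rewrite -{}pq in qe'.
  by rewrite -(def_pblock tD eD pe) (def_pblock tD e'D qe').
apply: contra (notin_cover_setD1 tD eD pe) => /bigcupP[B BD pB].
by apply/bigcupP; exists B => //; move: BD; rewrite inE => /andP[].
Qed.

Lemma state_sum_setD1 D F f e p : trivIset D -> e \in D -> p \in e ->
  state_sum D F f = \sum_n beta n *: state_sum (D :\ e) F (setv f e (J n)).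
Proof.
move=> tD eD pe; rewrite -{1}(setD1K eD) state_sum_setU1 ?setD1K //.
  by rewrite !inE eqxx.
by apply/set0Pn; exists p.
Qed.

(** Invariance: the ends of one chord, differentiated in turn, cancel. *)
Lemma state_sum_drv_chord D F m p q f :
  p != q -> [set p; q] \in D -> trivIset D -> lin_at p F -> lin_at q F ->
  state_sum D (fun g => F (drv m p g)) f
  + state_sum D (fun g => F (drv m q g)) f = 0.
Proof.
move=> pq pqD tD lp lq; set e := [set p; q] in pqD *.
have pe : p \in e by rewrite !inE eqxx.
have qe : q \in e by rewrite !inE eqxx orbT.
have pD' := notin_cover_setD1 tD pqD pe; have qD' := notin_cover_setD1 tD pqD qe.
rewrite !(state_sum_setD1 _ _ tD pqD pe).
under eq_bigr => n _ do rewrite state_sum_drv // setv2 // updC // drv_upd_same.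
under [X in _ + X]eq_bigr => n _ do rewrite state_sum_drv // setv2 // drv_upd_same.
rewrite -big_split -[RHS](ad_invariant JJ (bilin_upd2 f pq
  (state_sum_lin_at beta J pD' lp) (state_sum_lin_at beta J qD' lq)) m).
by apply: eq_bigr => n _; rewrite /= -scalerDr [upd (upd f q _) p _]updC // eq_sym.
Qed.

(** Adding a chord between two unused marks. *)
Lemma state_sum_add D F f p q : p != q -> p \notin cover D -> q \notin cover D ->
  trivIset D -> set0 \notin D ->
  trivIset ([set p; q] |: D) /\
  state_sum ([set p; q] |: D) F f
  = \sum_n beta n *: state_sum D F (upd (upd f p (J n)) q (J n)).
Proof.
move=> pq pD qD tD D0; have dis B : B \in D -> [disjoint [set p; q] & B].
  move=> BD; rewrite disjoints_subset; apply/subsetP => z.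
  rewrite !inE => /orP[] /eqP ->; [apply: contra pD|apply: contra qD] => zB;
  by apply/bigcupP; exists B.
have [tU nU] := trivIsetU1 dis tD D0; split=> //.
rewrite state_sum_setU1 //; last by apply/set0Pn; exists p; rewrite !inE eqxx.
by apply: eq_bigr => n _; rewrite setv2.
Qed.

(** Let u be an arc which contains one end l_i of each chord b_i and, of every
    other chord, both ends or none. A function on the marks that vanishes off the
    chords and has sum 0 on every chord inside u has the same sum over u as over
    the ends l_i. *)
Lemma sum_arc D (u : seq I) (k : nat) (b : 'I_k -> {set I}) (l r : 'I_k -> I)
    (g : I -> A) :
  trivIset D -> injective b -> (forall i, b i \in D) ->
  (forall i, b i = [set l i; r i]) ->
  (forall i, l i \in u) -> (forall i, r i \notin u) ->
  (forall e, e \in D -> e \notin codom b -> {subset e <= u} \/ [disjoint e & u]) ->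
  (forall p, p \notin cover D -> g p = 0) ->
  (forall e, e \in D -> {subset e <= u} -> \sum_(p in e) g p = 0) ->
  \sum_(p in u) g p = \sum_i g (l i).
Proof.
move=> tD binj bD be lu ru oth g0 gin.
pose h p := if p \in u then g p else 0.
have -> : \sum_(p in u) g p = \sum_(p in cover D) h p.
  rewrite big_mkcond [RHS]big_mkcond; apply: eq_bigr => p _; rewrite /h.
  by case: ifP => pu; case: ifPn => // /g0.
rewrite big_trivIset //= (bigID (mem [set b i | i in 'I_k])) /=.
rewrite [X in _ + X]big1 ?addr0 => [|e /andP[eD eb]]; last first.
  have ec : e \notin codom b.
    by apply: contra eb => /codomP[i ->]; apply: imset_f.
  have [eu|eu] := oth e eD ec; last by apply: big1 => p pe; rewrite /h (disjointFr eu pe).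
  by rewrite -[RHS](gin e eD eu); apply: eq_bigr => p /eu pu; rewrite /h pu.
rewrite (eq_bigl (mem [set b i | i in 'I_k])) => [|e]; last first.
  by rewrite /= andbC; case: imsetP => // -[i _ ->]; rewrite bD.
rewrite big_imset /= => [|i j _ _ /binj //].
apply: eq_bigr => i _; have lr : l i != r i by apply: contraNneq (ru i) => <-.
by rewrite be big_setU1 ?inE // big_set1 /h lu (negPf (ru i)) /= addr0.
Qed.

Section OneChord.
Variables (D : {set {set I}}) (a : {set I}) (x y : I) (s1 u s2 : seq I).
Variables (k : nat) (b : 'I_k -> {set I}) (l r : 'I_k -> I).
Hypothesis s_split : s = s1 ++ x :: u ++ y :: s2.
Hypothesis trivD : trivIset D.
Hypothesis card2 : {in D, forall e, #|e| = 2}.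
Hypothesis aD : a \in D.
Hypothesis a_ends : a = [set x; y].
Hypothesis b_inj : injective b.
Hypothesis b_in : forall i, b i \in D :\ a.
Hypothesis b_ends : forall i, b i = [set l i; r i].
Hypothesis l_in : forall i, l i \in u.
Hypothesis r_out : forall i, r i \notin u.
Hypothesis others : forall e, e \in D :\ a -> e \notin codom b ->
  {subset e <= u} \/ [disjoint e & u].

Local Notation Da := (D :\ a).

(** The weight of D - a, with [ad m] applied to the letter at p, then at q. *)
Definition second_drv m p q : A :=
  state_sum Da (fun g => W (drv m q (drv m p g))) f1.

Lemma triv_Da : trivIset Da.
Proof. by apply: trivIsetS trivD; apply: subsetDl. Qed.

Lemma uniq_u : uniq u.
Proof.
have := uniq_s; rewrite s_split cat_uniq /= cat_uniq.
by case/and4P=> _ _ _ /and3P[].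
Qed.

Lemma twisted_weight_casimir :
  twisted_weight D *+ 2 = (c * twisted_weight Da) *+ 2
    - \sum_m beta m *: \sum_(p in u) \sum_(q in u) second_drv m p q.
Proof.
have xa : x \in a by rewrite a_ends !inE eqxx.
have ya : y \in a by rewrite a_ends !inE eqxx orbT.
have xD := notin_cover_setD1 trivD aD xa; have yD := notin_cover_setD1 trivD aD ya.
have disa : [disjoint a & cover Da].
  rewrite disjoint_subset; apply/subsetP => p pa; rewrite inE /=.
  exact: notin_cover_setD1 trivD aD pa.
have us : uniq (s1 ++ x :: u ++ y :: s2) by rewrite -s_split.
have -> : twisted_weight D
    = state_sum Da (fun g => \sum_m beta m *: W (setv g a (J m))) f1.
  rewrite /twisted_weight (state_sum_setD1 _ _ trivD aD xa) state_sum_sum.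
  apply: eq_bigr => m _; rewrite state_sumZ; congr (_ *: _).
  by apply: eq_bigr => mu _; rewrite fill_setv.
transitivity (state_sum Da (fun g => (c *+ 2) * W g + (-1) *:
    \sum_m beta m *: \sum_(p in u) \sum_(q in u) W (drv m q (drv m p g))) f1).
  rewrite -sumrMnl; apply: eq_bigr => mu _; rewrite scalerMnr; congr (_ *: _).
  have := @word_chord _ eps _ _ J _ _ _ _ _ (fill J Da mu f1) us casimir_central
    (fill_notin _ _ _ xD) (fill_notin _ _ _ yD).
  rewrite -s_split -a_ends /= => ->; rewrite mulrnAl scaleN1r.
  congr (_ - _); apply: eq_bigr => m _; congr (_ *: _).
  rewrite big_uniq ?uniq_u //; apply: eq_bigr => p _.
  by rewrite big_uniq ?uniq_u.
rewrite state_sumD state_sum_mull mulrnAl state_sumZ scaleN1r state_sum_sum.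
congr (_ - _); apply: eq_bigr => m _; rewrite state_sumZ state_sum_sum.
by congr (_ *: _); apply: eq_bigr => p _; rewrite state_sum_sum.
Qed.

Lemma second_drvC m p q : second_drv m p q = second_drv m q p.
Proof. by apply: eq_bigr => mu _; rewrite drvC. Qed.

(** The chords that do not cross a drop out. *)
Lemma second_drv_ends m :
  \sum_(p in u) \sum_(q in u) second_drv m p q
  = \sum_i \sum_j second_drv m (l i) (l j).
Proof.
have red (g : I -> A) : (forall p, p \notin cover Da -> g p = 0) ->
    (forall e, e \in Da -> {subset e <= u} -> \sum_(p in e) g p = 0) ->
    \sum_(p in u) g p = \sum_i g (l i).
  exact: (sum_arc triv_Da b_inj b_in b_ends l_in r_out others).
have z0 q p : p \notin cover Da -> second_drv m p q = 0.
  move=> pD; rewrite /second_drv (state_sum_drv (fun g => W (drv m q g))) //.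
  rewrite /drv ad1.
  apply: (@lin_at0 _ _ _ p (state_sum Da (fun g => W (upd g q (ad m (g q)))))).
  exact/state_sum_lin_at/lin_drv/lin_word.
have z1 q e : e \in Da -> {subset e <= u} -> \sum_(p in e) second_drv m p q = 0.
  move=> eD eu; have /cards2P[p [p' [pp' ee]]] : #|e| == 2%N.
    by apply/eqP/card2; move: eD; rewrite !inE => /andP[].
  rewrite ee big_setU1 ?inE // big_set1; rewrite ee in eD.
  apply: (@state_sum_drv_chord Da (fun g => W (drv m q g)) m p p' f1 pp' eD triv_Da);
    exact/lin_drv/lin_word.
rewrite red => [|p pD|e eD eu].
- apply: eq_bigr => i _; apply: red => [p pD|e eD eu].
    by rewrite second_drvC z0.
  by rewrite -[RHS](z1 (l i) e eD eu); apply: eq_bigr => p _; rewrite second_drvC.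
- by rewrite big1 // => q _; rewrite z0.
- by rewrite exchange_big big1 // => q _; rewrite z1.
Qed.

Local Notation Dai i := (Da :\ b i).
Local Notation Daij i j := (Da :\ b i :\ b j).
Local Notation Z := (J ord0).
Local Notation w := twisted_weight.

Lemma l_neq_r i j : l i != r j.
Proof. by apply: contraNneq (r_out j) => <-. Qed.

Lemma upd_f1 p : upd f1 p 1 = f1.
Proof. exact: (upd_id f1 p). Qed.

Lemma second_drv_same i :
  \sum_m beta m *: second_drv m (l i) (l i)
  = (eps *: (w Da - Z ^+ 2 * w (Dai i))) *+ 2.
Proof.
have lb : l i \in b i by rewrite b_ends !inE eqxx.
have rb : r i \in b i by rewrite b_ends !inE eqxx orbT.
have lD := notin_cover_setD1 triv_Da (b_in i) lb.
have rD := notin_cover_setD1 triv_Da (b_in i) rb.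
have cZ := central_J0 JJ.
pose G := state_sum (Dai i) W; pose g n := upd f1 (r i) (J n).
have ll : lin_at (l i) G by apply: state_sum_lin_at => //; apply: lin_word.
have lr : lin_at (r i) G by apply: state_sum_lin_at => //; apply: lin_word.
have sv n : setv f1 (b i) (J n) = upd (g n) (l i) (J n).
  by rewrite b_ends setv2 ?l_neq_r // updC ?l_neq_r.
have wE : w Da = Z ^+ 2 * w (Dai i) + \sum_(n | n != ord0) beta n *: G (upd (g n) (l i) (J n)).
  rewrite /w (state_sum_setD1 _ _ triv_Da (b_in i) lb) sum_nonzero.
  congr (_ + _); last by apply: eq_bigr => n _; rewrite sv.
  rewrite sv (beta0 eps) scale1r expr2 -mulrA /g.
  rewrite -[Z in upd (upd _ _ _) _ Z]mulr1 -/G (lin_atM ll) //; congr (_ * _).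
  rewrite updC 1?eq_sym ?l_neq_r // upd_f1 -[X in upd _ _ X]mulr1 (lin_atM lr) //.
  by rewrite upd_f1.
have -> : w Da - Z ^+ 2 * w (Dai i)
    = \sum_(n | n != ord0) beta n *: G (upd (g n) (l i) (J n)).
  by rewrite wE addrC addKr.
have dE m : second_drv m (l i) (l i)
    = \sum_n beta n *: G (upd (g n) (l i) (ad m (ad m (J n)))).
  rewrite /second_drv (state_sum_setD1 _ _ triv_Da (b_in i) lb).
  apply: eq_bigr => n _; congr (_ *: _).
  rewrite (state_sum_drv (fun g => W (drv m (l i) g))) // state_sum_drv //.
  by rewrite sv !drv_upd_same.
under eq_bigr => m _ do rewrite dE scaler_sumr.
rewrite exchange_big /= scaler_sumr -sumrMnl [RHS]big_mkcond.
apply: eq_bigr => n _.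
transitivity (beta n *: G (upd (g n) (l i) (\sum_m beta m *: ad m (ad m (J n))))).
  rewrite (lin_at_sum ll) scaler_sumr; apply: eq_bigr => m _.
  by rewrite (lin_atZ ll) !scalerA mulrC.
rewrite (ad_ad_J JJ); case: eqP => _ /=; first by rewrite (lin_at0 ll) scaler0.
by rewrite !mulr2n (lin_atD ll) (lin_atZ ll) scalerDr !scalerA mulrC.
Qed.

Lemma second_drv_distinct i j : i != j ->
  \sum_m beta m *: second_drv m (l i) (l j)
  = eps *: (
     (w ([set r i; l j] |: ([set l i; r j] |: Daij i j))
      - Z ^+ 2 * (w ([set l i; r j] |: Daij i j) + w ([set r i; l j] |: Daij i j)))
    - (w ([set r i; r j] |: ([set l i; l j] |: Daij i j))
      - Z ^+ 2 * (w ([set l i; l j] |: Daij i j) + w ([set r i; r j] |: Daij i j)))).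
Proof.
move=> ij.
have lb h : l h \in b h by rewrite b_ends !inE eqxx.
have rb h : r h \in b h by rewrite b_ends !inE eqxx orbT.
have bij : b i != b j by apply: contra ij => /eqP/b_inj ->.
have bj : b j \in Dai i by rewrite in_setD1 eq_sym bij b_in.
have tDi : trivIset (Dai i) by apply: trivIsetS triv_Da; apply: subsetDl.
have tDij : trivIset (Daij i j) by apply: trivIsetS tDi; apply: subsetDl.
have n0 : set0 \notin Daij i j.
  apply/negP; rewrite !inE => /and4P[_ _ _ /card2]; rewrite cards0 //.
have pm p q := @chord_pair_marks Da (b i) (b j) p q triv_Da (b_in i) (b_in j) bij.
have [d13 li lj] := pm _ _ (lb i) (lb j); have [d14 _ rj] := pm _ _ (lb i) (rb j).
have [d23 ri _] := pm _ _ (rb i) (lb j); have [d24 _ _] := pm _ _ (rb i) (rb j).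
have d12 : l i != r i := l_neq_r i i. have d34 : l j != r j := l_neq_r j j.
have ne := (negPf d12, negPf d34, negPf d13, negPf d14, negPf d23, negPf d24).
have ne' : (((r i == l i) = false) * ((r j == l j) = false) * ((l j == l i) = false)
  * ((r j == l i) = false) * ((l j == r i) = false) * ((r j == r i) = false))%type.
  by do !split; rewrite eq_sym ne.
pose G x1 x2 x3 x4 := state_sum (Daij i j) W
  (upd (upd (upd (upd f1 (l i) x1) (r i) x2) (l j) x3) (r j) x4).
have Gtetra : tetralinear G.
  split=> [x2 x3 x4|x1 x3 x4|x1 x2 x4|x1 x2 x3] z v v' cz; rewrite /G.
  - rewrite ![upd (upd f1 _ _) (r i) _]updC // ![upd (upd _ (l i) _) (l j) _]updC //.
    by rewrite ![upd (upd _ (l i) _) (r j) _]updC // (state_sum_lin_at _ _ li) //; apply: lin_word.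
  - rewrite ![upd (upd _ (r i) _) (l j) _]updC //.
    by rewrite ![upd (upd _ (r i) _) (r j) _]updC // (state_sum_lin_at _ _ ri) //; apply: lin_word.
  - by rewrite ![upd (upd _ (l j) _) (r j) _]updC // (state_sum_lin_at _ _ lj) //; apply: lin_word.
  - by rewrite (state_sum_lin_at _ _ rj) //; apply: lin_word.
have two p q p' q' : p != q -> p' != q' -> p \notin [set p'; q'] -> q \notin [set p'; q'] ->
    p \notin cover (Daij i j) -> q \notin cover (Daij i j) ->
    p' \notin cover (Daij i j) -> q' \notin cover (Daij i j) ->
    w ([set p; q] |: ([set p'; q'] |: Daij i j))
    = \sum_n' \sum_n (beta n' * beta n) *: state_sum (Daij i j) W
        (upd (upd (upd (upd f1 p (J n)) q (J n)) p' (J n')) q' (J n')).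
  move=> pq pq' p2 q2 pD qD p'D q'D.
  have [tU sU] := state_sum_add W (upd (upd f1 p 1) q 1) pq' p'D q'D tDij n0.
  have [p'n pn] : [set p'; q'] \notin Daij i j /\ set0 \notin [set p'; q'] |: Daij i j.
    split; last rewrite in_setU1 negb_or n0 andbT eq_sym.
      by apply: contra p'D => p'D; apply/bigcupP; exists [set p'; q']; rewrite // !inE eqxx.
    by apply/set0Pn; exists p'; rewrite !inE eqxx.
  have cov t : t \notin [set p'; q'] -> t \notin cover (Daij i j) ->
      t \notin cover ([set p'; q'] |: Daij i j).
    by move=> t1 t2; rewrite /cover big_setU1 // inE negb_or t1.
  rewrite /w (state_sum_add _ _ pq (cov p p2 pD) (cov q q2 qD) tU pn).2.
  rewrite exchange_big; apply: eq_bigr => n _.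
  rewrite (state_sum_add _ _ pq' p'D q'D tDij n0).2 scaler_sumr.
  by apply: eq_bigr => n' _; rewrite scalerA mulrC.
have one p q : p != q -> p \notin cover (Daij i j) -> q \notin cover (Daij i j) ->
    w ([set p; q] |: Daij i j)
    = \sum_n beta n *: state_sum (Daij i j) W (upd (upd f1 p (J n)) q (J n)).
  by move=> pq pD qD; apply: (state_sum_add _ _ pq pD qD tDij n0).2.
have sv f h v : setv f (b h) v = upd (upd f (l h) v) (r h) v.
  by rewrite b_ends setv2 // l_neq_r.
have sE : \sum_m beta m *: second_drv m (l i) (l j)
    = \sum_m beta m *: (\sum_n \sum_n' (beta n * beta n') *:
      G (ad m (J n)) (J n) (ad m (J n')) (J n')).
  apply: eq_bigr => m _; congr (_ *: _).
  rewrite /second_drv (state_sum_setD1 _ _ triv_Da (b_in i) (lb i)).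
  apply: eq_bigr => n _; rewrite (state_sum_setD1 _ _ tDi bj (lb j)) scaler_sumr.
  apply: eq_bigr => n' _; rewrite scalerA; congr (_ *: _).
  rewrite (state_sum_drv (fun g => W (drv m (l j) g))) // state_sum_drv //.
  rewrite !sv (drv_upd _ _ _ d14) (drv_upd _ _ _ d13).
  by rewrite (drv_upd _ _ _ d12) drv_upd_same (drv_upd _ _ _ d34) drv_upd_same.
rewrite sE (contract_crossing_pair eps2 JJ Gtetra); congr (_ *: (_ - _ * (_ + _) - (_ - _ * (_ + _)))).
1,4: rewrite two ?inE ?ne ?ne' //; apply: eq_bigr => n _; apply: eq_bigr => n' _.
3-6: rewrite one //; apply: eq_bigr => n _.
all: congr (_ *: state_sum _ _ _); apply/funext => z; rewrite /upd /unit_word.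
all: by do ![case: (z =P _) => [zE|_]; rewrite ?zE ?eqxx ?ne ?ne' //].
Qed.

(** Division by 2 is needed, because the second derivatives give every unordered
    pair of chords twice. *)
Theorem twisted_weight_recurrence : (2%:R : K) != 0 ->
  w D = c * w Da - \sum_i eps *: (w Da - Z ^+ 2 * w (Dai i))
   - \sum_(i < k) \sum_(j < k | (i < j)%N) eps *: (
     (w ([set r i; l j] |: ([set l i; r j] |: Daij i j))
      - Z ^+ 2 * (w ([set l i; r j] |: Daij i j) + w ([set r i; l j] |: Daij i j)))
    - (w ([set r i; r j] |: ([set l i; l j] |: Daij i j))
      - Z ^+ 2 * (w ([set l i; l j] |: Daij i j) + w ([set r i; r j] |: Daij i j)))).
Proof.
move=> two0.
have halve (u1 u2 : A) : u1 *+ 2 = u2 *+ 2 -> u1 = u2.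
  by rewrite -!scaler_nat => /(scalerI two0).
pose T i j := \sum_m beta m *: second_drv m (l i) (l j).
have TC i j : T i j = T j i by apply: eq_bigr => m _; rewrite second_drvC.
apply: halve; rewrite twisted_weight_casimir !mulrnBl -[RHS]addrA -opprD; congr (_ - _).
transitivity (\sum_i \sum_j T i j).
  under eq_bigr => m _ do rewrite second_drv_ends scaler_sumr.
  rewrite exchange_big; apply: eq_bigr => i _ /=.
  under eq_bigr => m _ do rewrite scaler_sumr.
  by rewrite exchange_big.
transitivity (\sum_i (T i i + \sum_(j < k | (i < j)%N) T i j
                      + \sum_(j < k | (j < i)%N) T i j)).
  apply: eq_bigr => i _; rewrite (bigD1 i) //= -addrA; congr (_ + _).
  rewrite (bigID (fun j : 'I_k => (i < j)%N)) /=; congr (_ + _).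
    apply: eq_bigl => j; case: ltngtP; rewrite ?andbT ?andbF //.
      by move=> ij; rewrite -val_eqE /= gtn_eqF.
  apply: eq_bigl => j; rewrite -val_eqE /=; by case: ltngtP.
rewrite !big_split /= -addrA; congr (_ + _).
  by rewrite -sumrMnl; apply: eq_bigr => i _; apply: second_drv_same.
rewrite mulr2n; congr (_ + _).
  apply: eq_bigr => i _; apply: eq_bigr => j ij.
  by apply: second_drv_distinct; rewrite -val_eqE /= ltn_eqF.
rewrite (exchange_big_dep predT) //=; apply: eq_bigr => i _; apply: eq_bigr => j ij.
by rewrite TC; apply: second_drv_distinct; rewrite -val_eqE /= ltn_eqF.
Qed.

End OneChord.

End Recurrence.

(** * Cuts of the circle and crossings *)

Section Cuts.
Variable N : nat.
Implicit Types (t p q x y z : 'I_N) (e f : {set 'I_N}) (D : {set {set 'I_N}}).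

(** The marks in the order in which they are met after the cut before t. *)
Definition cut t : seq 'I_N := rot t (enum 'I_N).

Lemma cut_uniq t : uniq (cut t).
Proof. by rewrite rot_uniq enum_uniq. Qed.

Lemma mem_cut t p : p \in cut t.
Proof. by rewrite mem_rot mem_enum. Qed.

Lemma index_cut t p :
  index p (cut t) = (if t <= p then p - t else p + N - t)%N.
Proof.
have tN := ltn_ord t; have pN := ltn_ord p.
set k := (if _ then _ else _)%N.
have kN : (k < size (cut t))%N by rewrite size_rot size_enum_ord /k; case: (leqP t p); lia.
have <- : nth p (cut t) k = p; last by rewrite index_uniq ?cut_uniq.
rewrite nth_cat size_drop size_enum_ord nth_drop.
have [tp|pt] := leqP t p.
  have -> : (k < N - t)%N by rewrite /k tp; lia.
  have -> : (t + k = p)%N by rewrite /k tp; lia.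
  by rewrite nth_ord_enum.
have -> : (k < N - t)%N = false by rewrite /k ifN -?ltnNge //; lia.
have -> : (k - (N - t) = p)%N by rewrite /k ifN -?ltnNge //; lia.
by rewrite nth_take // nth_ord_enum.
Qed.

(** The cyclic order does not depend on the cut. *)
Lemma cyc_cut t x y z (pos := fun p => index p (cut t)) :
  cyc x y z = [|| (pos x < pos y < pos z)%N, (pos y < pos z < pos x)%N
                | (pos z < pos x < pos y)%N].
Proof.
rewrite /pos !index_cut /cyc.
have tN := ltn_ord t; have xN := ltn_ord x; have yN := ltn_ord y; have zN := ltn_ord z.
by case: (leqP t x) => ?; case: (leqP t y) => ?; case: (leqP t z) => ?; lia.
Qed.

Lemma crossesC e f : crosses e f = crosses f e.
Proof.
suff imp e' f' : crosses e' f' -> crosses f' e' by apply/idP/idP; apply: imp.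
case/existsP=> x /andP[xe] /existsP[y /andP[yf]] /existsP[z /andP[ze]].
case/existsP=> v /andP[vf] /andP[c1 c2].
apply/existsP; exists y; rewrite yf; apply/existsP; exists z; rewrite ze.
apply/existsP; exists v; rewrite vf; apply/existsP; exists x; rewrite xe /=.
by move: c1 c2; rewrite /cyc; lia.
Qed.

Lemma crosses_set2 x y z v :
  crosses [set x; y] [set z; v]
  = cyc x z y && cyc y v x || cyc x v y && cyc y z x.
Proof.
apply/idP/idP.
  case/existsP=> x' /andP[+] /existsP[y' /andP[+]] /existsP[z' /andP[+]].
  move=> + + + /existsP[v' /andP[+]]; rewrite !inE.
  do 4!case/orP=> /eqP->; rewrite /cyc; lia.
move=> h; apply/existsP.
have [/andP[c1 c2]|/andP[c1 c2]] := orP h; exists x; rewrite !inE eqxx /=.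
  apply/existsP; exists z; rewrite !inE eqxx /=; apply/existsP; exists y; rewrite !inE eqxx orbT /=.
  by apply/existsP; exists v; rewrite !inE eqxx orbT /= c1.
apply/existsP; exists v; rewrite !inE eqxx orbT /=; apply/existsP; exists y; rewrite !inE eqxx orbT /=.
by apply/existsP; exists z; rewrite !inE eqxx /= c1.
Qed.

Lemma cut_split2 t x y : x != y ->
  (exists s1 u s2, cut t = s1 ++ x :: u ++ y :: s2)
  \/ (exists s1 u s2, cut t = s1 ++ y :: u ++ x :: s2).
Proof.
move=> xy; have := mem_cut t y; have := mem_cut t x.
case/splitPr => s1 s2; rewrite mem_cat inE eq_sym (negPf xy) /= => /orP[] /splitPr[s3 s4].
  by right; exists s3, s4, s2; rewrite -catA.
by left; exists s1, s3, s4.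
Qed.

Section Arc.
Variables (t x y : 'I_N) (s1 u s2 : seq 'I_N).
Hypothesis cut_split : cut t = s1 ++ x :: u ++ y :: s2.

Lemma mem_arc p : (p \in u) = cyc x p y.
Proof.
have := cut_uniq t; rewrite cut_split cat_uniq /= mem_cat cat_uniq /= !inE.
rewrite !negb_or => /and3P[_ /andP[xs1 /hasPn hs1] /and3P[/and3P[xu xy xs2] _ /andP[/andP[yu _] _]]].
have ys1 : y \notin s1 by apply: hs1; rewrite mem_cat inE eqxx orbT.
have ix : index x (cut t) = size s1.
  by rewrite cut_split index_cat (negPf xs1) /= eqxx addn0.
have iy : index y (cut t) = (size s1 + (size u).+1)%N.
  rewrite cut_split index_cat (negPf ys1) /= (negPf xy) index_cat (negPf yu) /= eqxx.
  by rewrite addn0.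
have -> : (p \in u) = (size s1 < index p (cut t) < size s1 + (size u).+1)%N.
  rewrite cut_split index_cat /= index_cat.
  case: (boolP (p \in u)) => pu.
    have -> : (p \in s1) = false by apply/negbTE/hs1; rewrite mem_cat pu.
    have -> : (x == p) = false by apply/negbTE; apply: contraNneq xu => ->.
    by move: pu; rewrite -index_mem /=; lia.
  case: (boolP (p \in s1)) => [|_]; first by rewrite -index_mem /=; lia.
  by case: (x == p) => /=; lia.
by rewrite (cyc_cut t) ix iy; lia.
Qed.

(** A chord crosses [set x; y] when exactly one of its ends lies on the arc from
    x to y. *)
Lemma crosses_arc z v : z \notin [set x; y] -> v \notin [set x; y] ->
  crosses [set x; y] [set z; v] = (z \in u) (+) (v \in u).
Proof.
rewrite !inE !negb_or => /andP[zx zy] /andP[vx vy].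
rewrite crosses_set2 !mem_arc.
have xy : x != y.
  by have := cut_uniq t; rewrite cut_split cat_uniq /= mem_cat inE !negb_or => /and3P[_ _ /andP[/and3P[]]].
rewrite -!val_eqE /= in zx zy vx vy xy; move: zx zy vx vy xy; rewrite /cyc.
lia.
Qed.

End Arc.
End Cuts.

(** * The sign of a labelled diagram as a product of matrices *)

Section SignRule.
Variables (K : fieldType) (R : algType K) (gam : 'I_4 -> R) (sq : 'I_4 -> K).
Variables (N : nat) (t : 'I_N).
Implicit Types (e f : {set 'I_N}) (D : {set {set 'I_N}}) (mu : {ffun {set 'I_N} -> 'I_4}).
Local Notation sigma := (color_sign K).
Hypothesis gam_comm : forall m n, gam m * gam n = sigma m n *: (gam n * gam m).
Hypothesis gam_sqr : forall m, gam m * gam m = (sq m)%:A.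

Lemma color_signC m n : sigma m n = sigma n m.
Proof. by rewrite /color_sign eq_sym andbC -andbA andbC [(n != ord0) && _]andbC andbA. Qed.

Lemma color_sign_sqr m n : sigma m n * sigma m n = 1.
Proof. by rewrite /color_sign; case: ifP => _; rewrite ?mulr1 ?mulrNN ?mulr1. Qed.

(** The product of the signs over the unordered pairs of crossing chords. *)
Definition sign_product D mu : K :=
  \prod_(e in D) \prod_(f in D | (enum_rank e < enum_rank f)%N && crosses e f)
    sigma (mu e) (mu f).

Lemma sign_product_setD1 D mu e : e \in D ->
  sign_product D mu
  = (\prod_(f in D :\ e | crosses e f) sigma (mu e) (mu f))
    * sign_product (D :\ e) mu.
Proof.
move=> eD; pose G e f := if (enum_rank e < enum_rank f)%N && crosses e f
  then sigma (mu e) (mu f) else 1.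
have sE D' : sign_product D' mu = \prod_(e in D') \prod_(f in D') G e f.
  by apply: eq_bigr => e' _; rewrite big_mkcondr.
rewrite !sE (big_setD1 e) //= (big_setD1 e) //= {1}/G ltnn mul1r.
under [X in _ * X]eq_bigr => f _ do rewrite (big_setD1 e) //=.
rewrite big_split /= mulrA -big_split /=; congr (_ * _).
rewrite [RHS]big_mkcondr; apply: eq_bigr => f; rewrite !inE => /andP[fe _].
rewrite /G (crossesC f e) (color_signC (mu f)).
have : enum_rank f != enum_rank e by apply: contra fe => /eqP/enum_rank_inj ->.
rewrite -val_eqE /= => rfe.
by case: ltngtP rfe => //= _ _; case: ifP; rewrite ?mulr1 ?mul1r.
Qed.

Lemma gam_word m u (g : 'I_N -> R) (tau : 'I_N -> K) :
  (forall p, gam m * g p = tau p *: (g p * gam m)) ->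
  gam m * word u g = (\prod_(p <- u) tau p) *: (word u g * gam m).
Proof.
move=> gt; rewrite /word; elim: u => [|p u IH].
  by rewrite !big_nil mulr1 mul1r scale1r.
by rewrite !big_cons mulrA gt -scalerAl -[g p * gam m * _]mulrA IH -scalerAr scalerA mulrA.
Qed.

(** The factors of the two ends of a chord inside the arc cancel, as h f is a
    sign, so that only the chords crossing a contribute. *)
Lemma prod_arc (D : {set {set 'I_N}}) (a : {set 'I_N}) x y s1 u s2 (h : {set 'I_N} -> K) :
  cut t = s1 ++ x :: u ++ y :: s2 -> a = [set x; y] ->
  trivIset D -> {in D, forall f, #|f| = 2} -> [disjoint a & cover D] ->
  (forall f, h f * h f = 1) ->
  \prod_(p <- u) (if p \in cover D then h (pblock D p) else 1)
  = \prod_(f in D | crosses a f) h f.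
Proof.
move=> cs ae tD cD dis h2.
have uu : uniq u.
  by have := cut_uniq t; rewrite cs cat_uniq /= cat_uniq => /and4P[_ _ _ /and3P[]].
pose H p := if p \in u then h (pblock D p) else 1.
transitivity (\prod_(p in cover D) H p).
  rewrite big_uniq // big_mkcond [RHS]big_mkcond; apply: eq_bigr => p _.
  by rewrite /H; case: ifP => _; case: ifP.
rewrite big_trivIset //= [RHS]big_mkcondr; apply: eq_bigr => f fD.
have /cards2P[z [v [zv fE]]] : #|f| == 2%N by apply/eqP/cD.
have zf : z \in f by rewrite fE !inE eqxx.
have vf : v \in f by rewrite fE !inE eqxx orbT.
have nota p : p \in f -> p \notin a.
  by move=> pf; rewrite (disjointFl dis) //; apply/bigcupP; exists f.
have -> : \prod_(p in f) H p = H z * H v.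
  by rewrite fE big_setU1 ?inE //= big_set1.
have -> : crosses a f = (z \in u) (+) (v \in u).
  by rewrite fE {1}ae (crosses_arc cs) -?ae ?nota.
rewrite /H !(def_pblock tD fD) //.
by case: (z \in u); case: (v \in u); rewrite ?h2 ?mulr1 ?mul1r.
Qed.

(** A chord is removed by moving its first letter next to the second one. *)
Lemma word_sign D mu : chord_diagram D ->
  word (cut t) (fill gam D mu (unit_word R (I := 'I_N)))
  = ((\prod_(e in D) sq (mu e)) * sign_product D mu)%:A.
Proof.
have [n] := ubnP #|D|; elim: n => // n IH in D * => Dn.
case/andP=> /forall_inP c2 tD.
have [->|/set0Pn[a aD]] := eqVneq D set0.
  rewrite /word big1 => [|p _].
    by rewrite /sign_product !big_set0 mulr1 scale1r.
  by rewrite /fill /cover big_set0 inE.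
set D' := D :\ a.
have DE : D = a |: D' by rewrite setD1K.
have aD' : a \notin D' by rewrite !inE eqxx.
have tD' : trivIset D' by apply: trivIsetS tD; apply: subsetDl.
have tE : trivIset (a |: D') by rewrite -DE.
have cD' : {in D', forall f, #|f| = 2} by move=> f; rewrite !inE => /andP[_ /c2/eqP].
have [x [y [s1 [u [s2 [cs aE]]]]]] : exists x y s1 u s2,
    cut t = s1 ++ x :: u ++ y :: s2 /\ a = [set x; y].
  have /cards2P[x [y [xy ->]]] := c2 a aD.
  have [[s1 [u [s2 cs]]]|[s1 [u [s2 cs]]]] := cut_split2 t xy.
    by exists x, y, s1, u, s2.
  by exists y, x, s1, u, s2; rewrite setUC.
have dis := disjoint_cover aD' tE.
rewrite {1}DE fill_setU1 //; set g := fill _ _ _ _; set m := mu a.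
have xa : x \in a by rewrite aE !inE eqxx.
have ya : y \in a by rewrite aE !inE eqxx orbT.
have gx : g x = 1 by rewrite /g fill_notin ?(disjointFr dis).
have gy : g y = 1 by rewrite /g fill_notin ?(disjointFr dis).
have IHg : word (cut t) g = ((\prod_(e in D') sq (mu e)) * sign_product D' mu)%:A.
  apply: IH; first by move: Dn; rewrite (cardsD1 a) aD add1n ltnS.
  by apply/andP; split=> //; apply/forall_inP => f /cD' ->.
have gt p : gam m * g p
    = (if p \in cover D' then sigma m (mu (pblock D' p)) else 1) *: (g p * gam m).
  by rewrite /g /fill; case: ifP => _; [exact: gam_comm|rewrite mulr1 mul1r scale1r].
rewrite (sign_product_setD1 mu aD) (big_setD1 a aD) /= -/D' -/m.
rewrite -(prod_arc cs aE tD' cD' dis (fun f => color_sign_sqr m (mu f))).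
have us : uniq (s1 ++ x :: u ++ y :: s2) by rewrite -cs cut_uniq.
have gE : word (cut t) g = word s1 g * (g x * (word u g * (g y * word s2 g))).
  by rewrite cs /word big_cat big_cons big_cat big_cons.
rewrite gx gy !mul1r IHg in gE; rewrite cs aE word_setv2 //.
rewrite [gam m * _]mulrA (gam_word u gt) -scalerAl -!mulrA (mulrA (gam m)) gam_sqr.
rewrite mulr_algl -!(scalerAr, scalerAl) -gE !scalerA; congr (_ *: _).
ring.
Qed.

End SignRule.

(** * Two by two matrices over an algebra *)

Section TwistedAlgebra.
Variables (K : fieldType) (U : algType K).

(** The algebra of 2 x 2 matrices over U, as an algebra over the field K; the
    matrix type itself carries the structure of a module over U. *)
Definition mx2 : Type := 'M[U]_2.

HB.instance Definition _ := GRing.NzRing.copy mx2 'M[U]_2.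

Definition mx2_scale (a : K) (M : mx2) : mx2 := \matrix_(i, j) (a *: M i j).

Fact mx2_scaleA a b M : mx2_scale a (mx2_scale b M) = mx2_scale (a * b) M.
Proof. by apply/matrixP => i j; rewrite !mxE scalerA. Qed.

Fact mx2_scale1 : left_id 1 mx2_scale.
Proof. by move=> M; apply/matrixP => i j; rewrite !mxE scale1r. Qed.

Fact mx2_scaleDr : right_distributive mx2_scale +%R.
Proof. by move=> a M P; apply/matrixP => i j; rewrite !mxE scalerDr. Qed.

Fact mx2_scaleDl M : {morph mx2_scale^~ M : a b / a + b}.
Proof. by move=> a b; apply/matrixP => i j; rewrite !mxE scalerDl. Qed.

HB.instance Definition _ := GRing.Zmodule_isLmodule.Build K mx2
  mx2_scaleA mx2_scale1 mx2_scaleDr mx2_scaleDl.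

Fact mx2_scaleAl a (M P : mx2) : a *: (M * P) = a *: M * P.
Proof.
apply/matrixP => i j; rewrite !mxE scaler_sumr; apply: eq_bigr => l _.
by rewrite !mxE scalerAl.
Qed.

HB.instance Definition _ := GRing.Lmodule_isLalgebra.Build K mx2 mx2_scaleAl.

Fact mx2_scaleAr a (M P : mx2) : a *: (M * P) = M * (a *: P).
Proof.
apply/matrixP => i j; rewrite !mxE scaler_sumr; apply: eq_bigr => l _.
by rewrite !mxE scalerAr.
Qed.

HB.instance Definition _ := GRing.Lalgebra_isAlgebra.Build K mx2 mx2_scaleAr.

(** The tensor product of u with a scalar matrix g. *)
Definition tens (u : U) (g : 'M[K]_2) : mx2 := \matrix_(i, j) (g i j *: u).

Definition embed (u : U) : mx2 := tens u 1.

Lemma tensM u v g h : tens u g * tens v h = tens (u * v) (g * h).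
Proof.
apply/matrixP => i j; rewrite !mxE scaler_suml; apply: eq_bigr => l _.
by rewrite !mxE -scalerAl -scalerAr scalerA.
Qed.

Lemma tensDl u v g : tens (u + v) g = tens u g + tens v g.
Proof. by apply/matrixP => i j; rewrite !mxE scalerDr. Qed.

Lemma tensZl a u g : tens (a *: u) g = a *: tens u g.
Proof. by apply/matrixP => i j; rewrite !mxE !scalerA mulrC. Qed.

Lemma tensZr a u g : tens u (a *: g) = a *: tens u g.
Proof. by apply/matrixP => i j; rewrite !mxE !scalerA. Qed.

Lemma tens11 : tens 1 1 = 1.
Proof. by apply/matrixP => i j; rewrite !mxE; case: (i == j); rewrite ?scale1r ?scale0r. Qed.

Lemma embed_is_linear : linear embed.
Proof. by move=> a u v; rewrite /embed tensDl tensZl. Qed.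

Lemma embed_is_monoid_morphism : monoid_morphism embed.
Proof. by split=> [|u v]; rewrite /embed ?tens11 // tensM mulr1. Qed.

HB.instance Definition _ := GRing.isLinear.Build K U mx2 *:%R embed embed_is_linear.
HB.instance Definition _ := GRing.isMonoidMorphism.Build U mx2 embed embed_is_monoid_morphism.

Lemma embed_inj : injective embed.
Proof. by move=> u v /matrixP/(_ 0 0); rewrite !mxE eqxx !scale1r. Qed.

Lemma embed_central z : central z -> central (embed z).
Proof.
move=> cz M; apply/matrixP => i j; rewrite !mxE (bigD1 i) //= big1 => [|l li].
  rewrite (bigD1 j) //= big1 => [|l lj]; first by rewrite !mxE !eqxx !scale1r cz.
  by rewrite !mxE (negPf lj) scale0r mulr0.
by rewrite !mxE eq_sym (negPf li) scale0r mul0r.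
Qed.

(** The Pauli-type matrices: gamma1 is diagonal with entries 1 and -1, gamma2
    exchanges the two basis vectors, and gamma3 is their product. *)
Definition gamma1 : 'M[K]_2 := \matrix_(i, j) (if i == j then (-1) ^+ i else 0).
Definition gamma2 : 'M[K]_2 := \matrix_(i, j) (i != j)%:R.

Definition gamma3 : 'M[K]_2 := gamma1 * gamma2.

Definition gam (m : 'I_4) : 'M[K]_2 :=
  [:: 1; gamma1; gamma2; gamma3]`_m.

(** The square of [gam m]. *)
Definition gam_sq (m : 'I_4) : K := if m == 3%N :> nat then -1 else 1.

Lemma gamma1_sqr : gamma1 * gamma1 = 1.
Proof.
apply/matrixP => i j; rewrite !mxE !big_ord_recl big_ord0 !mxE.
by case: i => -[|[|//]] ?; case: j => -[|[|//]] ?; rewrite /= ?mulr0 ?mul0r ?mulr1 ?addr0 ?add0r ?mulrNN ?mulr1.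
Qed.

Lemma gamma2_sqr : gamma2 * gamma2 = 1.
Proof.
apply/matrixP => i j; rewrite !mxE !big_ord_recl big_ord0 !mxE.
by case: i => -[|[|//]] ?; case: j => -[|[|//]] ?; rewrite /= ?mulr0 ?mul0r ?mulr1 ?addr0 ?add0r ?mulrNN ?mulr1.
Qed.

Lemma gamma12 : gamma1 * gamma2 = gamma3. Proof. by []. Qed.

Lemma gamma21 : gamma2 * gamma1 = - gamma3.
Proof.
apply/matrixP => i j; rewrite !mxE !big_ord_recl !big_ord0 !mxE.
case: i => -[|[|//]] ?; case: j => -[|[|//]] ?;
by rewrite /= ?mulr0 ?mul0r ?mulr1 ?mul1r ?addr0 ?add0r ?oppr0 ?opprK.
Qed.

Lemma gamma13 : gamma1 * gamma3 = gamma2.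
Proof. by rewrite mulrA gamma1_sqr mul1r. Qed.

Lemma gamma31 : gamma3 * gamma1 = - gamma2.
Proof. by rewrite -mulrA gamma21 mulrN gamma13. Qed.

Lemma gamma32 : gamma3 * gamma2 = gamma1.
Proof. by rewrite -mulrA gamma2_sqr mulr1. Qed.

Lemma gamma23 : gamma2 * gamma3 = - gamma1.
Proof. by rewrite mulrA gamma21 mulNr gamma32. Qed.

Lemma gamma33 : gamma3 * gamma3 = -1.
Proof. by rewrite {1}/gamma3 -mulrA gamma23 mulrN gamma1_sqr. Qed.

Definition gam_table := (gamma1_sqr, gamma2_sqr, gamma33, gamma12, gamma21,
  gamma13, gamma31, gamma23, gamma32).

Lemma gam_inord0 : gam (inord 0) = 1. Proof. by rewrite /gam inordK. Qed.
Lemma gam_inord1 : gam (inord 1) = gamma1. Proof. by rewrite /gam inordK. Qed.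
Lemma gam_inord2 : gam (inord 2) = gamma2. Proof. by rewrite /gam inordK. Qed.
Lemma gam_inord3 : gam (inord 3) = gamma3. Proof. by rewrite /gam inordK. Qed.
Definition gam_inord := (gam_inord0, gam_inord1, gam_inord2, gam_inord3).

Lemma gam_comm m n : gam m * gam n = color_sign K m n *: (gam n * gam m).
Proof.
rewrite /color_sign -inord0E.
elim/I4_case: m; elim/I4_case: n; rewrite ?eqxx ?inord4_eqE /= ?gam_inord ?gam_table
  ?mulr1 ?mul1r ?scale1r ?scaleN1r ?opprK //.
Qed.

Lemma gam_sqr m : gam m * gam m = (gam_sq m)%:A.
Proof.
by elim/I4_case: m; rewrite gam_inord ?gam_table ?mulr1 /gam_sq inordK //= ?scale1r ?scaleN1r.
Qed.

End TwistedAlgebra.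

(** * Twisting the generators *)

Section Untwisting.
Variables (K : fieldType) (eps : K) (U : algType K) (Q : 'I_4 -> U).
Local Notation q i := (Q (inord i)).
Hypothesis Q0_central : central (q 0).
Hypothesis Q12 : q 1 * q 2 + q 2 * q 1 = q 3.
Hypothesis Q23 : q 2 * q 3 + q 3 * q 2 = eps *: q 1.
Hypothesis Q31 : q 3 * q 1 + q 1 * q 3 = q 2.

Definition twist (m : 'I_4) : mx2 U := tens (Q m) (gam K m).

Lemma tensNr (u : U) (g : 'M[K]_2) : tens u (- g) = - tens u g.
Proof. by rewrite -scaleN1r tensZr scaleN1r. Qed.

Lemma twist_triple : twisted_triple eps twist.
Proof.
rewrite /twisted_triple /ad /twist !tensM !gam_inord !gam_table.
split.
- exact: embed_central Q0_central.
- by rewrite tensNr opprK -tensDl Q12.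
- by rewrite tensNr -opprD -tensDl Q23 tensZl.
- by rewrite tensNr -opprD -tensDl Q31.
Qed.

Lemma twist_sqr m : twist m * twist m = gam_sq K m *: embed (Q m * Q m).
Proof. by rewrite tensM gam_sqr tensZr. Qed.

Lemma gam_sq_sqr m : gam_sq K m * gam_sq K m = 1.
Proof. by rewrite /gam_sq; case: ifP; rewrite ?mulrNN ?mulr1. Qed.

Lemma twist_casimir : casimir_elt eps twist
  = embed (q 0 ^+ 2 + eps *: q 1 ^+ 2 + q 2 ^+ 2 + q 3 ^+ 2).
Proof.
have bE m : beta eps m *: twist m ^+ 2 = embed (form_coef eps m *: Q m ^+ 2).
  rewrite !expr2 twist_sqr scalerA /embed tensZl; congr (_ *: _).
  by rewrite /beta -mulrA gam_sq_sqr mulr1.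
rewrite /casimir_elt; under eq_bigr => m _ do rewrite bE.
by rewrite -linear_sum sum_I4 /form_coef !inordK //= !scale1r.
Qed.

Lemma ad_casimir n : ad twist n (casimir_elt eps twist) = 0.
Proof.
rewrite /casimir_elt linear_sum.
have B : bilin (fun x y : mx2 U => x * y).
  by split=> [a x x' y|a x y y']; rewrite ?mulrDl ?mulrDr -?scalerAl -?scalerAr.
rewrite -[RHS](ad_invariant twist_triple B n).
by apply: eq_bigr => m _; rewrite linearZ /= expr2 adM.
Qed.

(** The twisted Casimir element commutes with the twisted generators, by
    invariance; multiplying by the invertible matrix gamma_n brings this back to
    U. *)
Lemma casimir_commutes (c := q 0 ^+ 2 + eps *: q 1 ^+ 2 + q 2 ^+ 2 + q 3 ^+ 2) n :
  c * Q n = Q n * c.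
Proof.
apply: (@embed_inj K); have /eqP := ad_casimir n.
rewrite subr_eq0 twist_casimir -/c tensM mulr1 /embed tensM mul1r.
move/eqP/(congr1 (fun M : mx2 U => M * tens 1 (gam K n))).
rewrite !tensM !mulr1 gam_sqr !tensZr /gam_sq.
by case: ifP => _; [rewrite !scaleN1r => /oppr_inj|rewrite !scale1r].
Qed.

(** The weight with signs is the sum without signs of the words in the twisted
    generators. *)
Lemma embed_state_sum N (t : 'I_N) D : chord_diagram D ->
  embed (\sum_(mu : {ffun {set 'I_N} -> 'I_4} | mu \in pffun_on ord0 (mem D) predT)
    ((\prod_(e in D) form_coef eps (mu e)) * sign_product K D mu) *:
    \prod_(p <- rot t (enum 'I_N) | p \in cover D) Q (mu (pblock D p)))
  = twisted_weight eps twist (cut t) D.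
Proof.
move=> cD; rewrite linear_sum; apply: eq_bigr => mu _; rewrite linearZ /=.
have -> : word (cut t) (fill twist D mu (unit_word _ (I := 'I_N)))
   = tens (\prod_(p <- rot t (enum 'I_N) | p \in cover D) Q (mu (pblock D p)))
       (word (cut t) (fill (gam K) D mu (unit_word _ (I := 'I_N)))).
  rewrite /word /cut; elim: (rot _ _) => [|p s IH]; first by rewrite !big_nil tens11.
  rewrite !big_cons IH {1 3}/fill; case: ifP => _; first by rewrite tensM.
  by rewrite !mul1r.
rewrite (word_sign t (@gam_comm K) (@gam_sqr K) mu cD) tensZr scalerA; congr (_ *: _).
rewrite /beta big_split /= -!mulrA; congr (_ * _).
rewrite mulrA -big_split big1 /= ?mul1r // => e _.
exact: gam_sq_sqr.
Qed.

End Untwisting.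

(** * The enveloping algebra *)

Section Enveloping.
Variables (K : fieldType) (eps : K).
Local Notation U := (envalg eps).
Local Notation Q := (@Qgen K eps).

Lemma envalg_central_gens (z : U) :
  (forall i, z * Q i = Q i * z) -> central z.
Proof.
move=> zQ v; have [x ->] := envalg_piP v.
have zU (k : {fmonom 'I_4}) : z * envalg_pi eps << k >> = envalg_pi eps << k >> * z.
  rewrite -[k]fmK; elim: (fmonom_val k) => [|i s IH].
    have -> : << FMonom [::] >> = 1 :> {malg K[{fmonom 'I_4}]} by rewrite -fmoneE.
    by apply: etrans (mulr1 z) (esym (mul1r z)).
  have -> : << FMonom (i :: s) >> = free_gen K i * << FMonom s >>.
    rewrite /free_gen; apply: esym; apply: etrans (fgmulUU _ _ _ _) _.
    by rewrite mulr1; congr << _ *g _ >>; apply/eqP; rewrite fmP fmM fmU.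
  have -> : envalg_pi eps (free_gen K i * << FMonom s >>)
      = Q i * envalg_pi eps << FMonom s >> := envalg_piM _ _ _.
  exact: (commrM (zQ i) IH).
rewrite [x]monalgE; elim/big_ind: _ => [|x1 x2 e1 e2|k _].
- have e0 : envalg_pi eps (0 + 0) = envalg_pi eps 0 + envalg_pi eps 0 := envalg_piD _ _ _.
  rewrite (addr0 (0 : {malg K[{fmonom 'I_4}]})) in e0.
  move: e0; set e := envalg_pi eps 0 => e0.
  have -> : e = 0 by apply: (addrI e); rewrite -e0 addr0.
  exact: commr0.
- have -> : envalg_pi eps (x1 + x2) = envalg_pi eps x1 + envalg_pi eps x2 := envalg_piD _ _ _.
  exact: (commrD e1 e2).
have -> : << x@_k *g k >> = x@_k *: << k >> :> {malg K[{fmonom 'I_4}]}.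
  apply/malgP => k'; apply: etrans (mcoeffU _ _ _) _; apply: esym.
  apply: etrans (mcoeffZ _ _ _) _; apply: etrans (congr1 _ (mcoeffU _ _ _)) _.
  exact: (mulr_natr (x@_k) (k == k')).
have -> : envalg_pi eps (x@_k *: << k >>) = x@_k *: envalg_pi eps << k >> := envalg_piZ _ _ _.
by apply: etrans (esym (scalerAr _ _ _)) _; rewrite zU scalerAl.
Qed.

Lemma Qgen0_central : central (Q (inord 0)).
Proof.
apply: envalg_central_gens; elim/I4_case.
- exact: erefl.
- exact: Qgen01.
- exact: Qgen02.
- exact: Qgen03.
Qed.

Lemma casimir_central : central (casimir eps).
Proof.
apply: envalg_central_gens.
exact: (casimir_commutes Qgen0_central (Qgen12 eps) (Qgen23 eps) (Qgen31 eps)).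
Qed.

Lemma embed_weight N (t : 'I_N) D : chord_diagram D ->
  embed (weight eps t D) = twisted_weight eps (twist Q) (cut t) D.
Proof. exact: (embed_state_sum eps Q). Qed.

End Enveloping.

(** * Resolution of the crossing chords *)

Section ChordDiagramClosure.
Variable N : nat.
Implicit Types (D : {set {set 'I_N}}) (e : {set 'I_N}) (x y z : 'I_N).

Lemma chord_diagramP D :
  reflect ({in D, forall e, #|e| = 2} /\ trivIset D) (chord_diagram D).
Proof.
apply: (iffP andP) => -[h1 h2]; split=> //; last by apply/forall_inP => e /h1 ->.
by move=> e /(forall_inP h1)/eqP.
Qed.

Lemma chord_diagramS D D' : D' \subset D -> chord_diagram D -> chord_diagram D'.
Proof.
move=> sD /chord_diagramP[c2 tD]; apply/chord_diagramP; split.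
  by move=> e /(subsetP sD)/c2.
exact: trivIsetS tD.
Qed.

Lemma cover_setU1 D e p : (p \in cover (e |: D)) = (p \in e) || (p \in cover D).
Proof.
apply/bigcupP/orP => [[B]|[pe|/bigcupP[B BD pB]]].
- by rewrite !inE => /orP[/eqP->|BD] pB; [left|right; apply/bigcupP; exists B].
- by exists e; rewrite ?setU11.
- by exists B; rewrite ?setU1r.
Qed.

Lemma chord_diagram_add D p q : p != q -> p \notin cover D -> q \notin cover D ->
  chord_diagram D -> chord_diagram (add_chord D p q).
Proof.
move=> pq pD qD /chord_diagramP[c2 tD]; apply/chord_diagramP; split.
  by move=> e; rewrite !inE => /orP[/eqP->|/c2//]; rewrite cards2 pq.
apply: (trivIsetU1 _ tD _).1 => [B BD|]; last first.
  by apply/negP => /c2; rewrite cards0.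
rewrite disjoint_sym disjoints_subset; apply/subsetP => z zB.
have zD : z \in cover D by apply/bigcupP; exists B.
by rewrite !inE; apply/norP; split; apply: contraTneq zD => ->.
Qed.

Lemma cyc_neq x y z : cyc x y z -> [/\ x != y, y != z & x != z].
Proof. by rewrite /cyc -!val_eqE /= => h; split; lia. Qed.

Lemma cyc_asym x y z : cyc x y z -> cyc z y x = false.
Proof. by rewrite /cyc; lia. Qed.

End ChordDiagramClosure.

Section CrossingChords.
Variable N : nat.
Variables (D : {set {set 'I_N}}) (a : {set 'I_N}) (x y : 'I_N).
Variables (k : nat) (b : 'I_k -> {set 'I_N}) (l r : 'I_k -> 'I_N).
Hypothesis D_diagram : chord_diagram D.
Hypothesis aD : a \in D.
Hypothesis a_ends : a = [set x; y].
Hypothesis b_inj : injective b.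
Hypothesis b_cross : forall e, ((e \in D) && crosses a e) = (e \in codom b).
Hypothesis b_ends : forall i, b i = [set l i; r i].
Hypothesis l_arc : forall i, cyc x (l i) y.
Hypothesis r_arc : forall i, cyc y (r i) x.

Local Notation Da := (D :\ a).
Local Notation Dai i := (Da :\ b i).
Local Notation Daij i j := (Da :\ b i :\ b j).
Local Notation par i j :=
  (add_chord (add_chord (Daij i j) (l i) (l j)) (r i) (r j)).
Local Notation cross i j :=
  (add_chord (add_chord (Daij i j) (l i) (r j)) (r i) (l j)).
Local Notation lr i j := (add_chord (Daij i j) (l i) (r j)).
Local Notation rl i j := (add_chord (Daij i j) (r i) (l j)).
Local Notation ll i j := (add_chord (Daij i j) (l i) (l j)).
Local Notation rr i j := (add_chord (Daij i j) (r i) (r j)).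

Lemma b_in i : b i \in Da.
Proof.
have /andP[bD _] : (b i \in D) && crosses a (b i) by rewrite b_cross codom_f.
rewrite in_setD1 bD andbT; apply/eqP => ba.
have : l i \in a by rewrite -ba b_ends !inE eqxx.
have [xl ly _] := cyc_neq (l_arc i).
by rewrite a_ends !inE eq_sym (negPf xl) (negPf ly).
Qed.

Lemma b_ends_neq i : l i != r i.
Proof. by apply: contraTneq (r_arc i) => <-; rewrite (cyc_asym (l_arc i)). Qed.

Lemma chord_diagram_Da : chord_diagram Da.
Proof. by apply: chord_diagramS D_diagram; apply: subsetDl. Qed.

Lemma chord_diagram_Dai i : chord_diagram (Dai i).
Proof. by apply: chord_diagramS chord_diagram_Da; apply: subsetDl. Qed.

(** The diagrams of the recurrence attached to a pair of crossing chords. *)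
Lemma resolved_diagrams i j : b i != b j ->
  [/\ chord_diagram (ll i j), chord_diagram (rr i j), chord_diagram (lr i j),
      chord_diagram (rl i j) & chord_diagram (par i j) /\ chord_diagram (cross i j)].
Proof.
move=> bij.
have lb h : l h \in b h by rewrite b_ends !inE eqxx.
have rb h : r h \in b h by rewrite b_ends !inE eqxx orbT.
have [_ tDa] := chord_diagramP _ chord_diagram_Da.
have cDij : chord_diagram (Daij i j).
  by apply: chord_diagramS (chord_diagram_Dai i); apply: subsetDl.
have pm p p' := @chord_pair_marks _ Da (b i) (b j) p p' tDa (b_in i) (b_in j) bij.
have [d13 li lj] := pm _ _ (lb i) (lb j); have [d14 _ rj] := pm _ _ (lb i) (rb j).
have [d23 ri _] := pm _ _ (rb i) (lb j); have [d24 _ _] := pm _ _ (rb i) (rb j).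
have d12 := b_ends_neq.
have cll := chord_diagram_add d13 li lj cDij.
have crr := chord_diagram_add d24 ri rj cDij.
have clr := chord_diagram_add d14 li rj cDij.
have crl := chord_diagram_add d23 ri lj cDij.
have out p p' z : z != p -> z != p' -> z \notin cover (Daij i j) ->
    z \notin cover (add_chord (Daij i j) p p').
  by move=> zp zp' zD; rewrite cover_setU1 !inE !negb_or zp zp'.
by do !split => //; apply: chord_diagram_add => //; apply: out => //; rewrite eq_sym.
Qed.

End CrossingChords.

(** The chords crossing a given chord, with their ends on its two sides. *)
Lemma crossing_chords N (D : {set {set 'I_N}}) a x y :
  chord_diagram D -> a \in D -> a = [set x; y] ->
  exists k (b : 'I_k -> {set 'I_N}) (l r : 'I_k -> 'I_N),
  [/\ injective b,
      forall e, ((e \in D) && crosses a e) = (e \in codom b),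
      forall i, b i = [set l i; r i],
      forall i, cyc x (l i) y & forall i, cyc y (r i) x].
Proof.
move=> /chord_diagramP[c2 tD] aD aE; pose C := [set e in D | crosses a e].
have ends (i : 'I_#|C|) : exists lr : 'I_N * 'I_N,
    [/\ enum_val i = [set lr.1; lr.2], cyc x lr.1 y & cyc y lr.2 x].
  have := enum_valP i; rewrite inE => /andP[eD].
  have /cards2P[z [v [_ ->]]] : #|enum_val i| == 2%N by rewrite c2.
  rewrite aE crosses_set2 => /orP[] /andP[c1 c3]; first by exists (z, v).
  by exists (v, z); rewrite setUC.
have [lr lrP] := fin_all_exists ends.
exists #|C|, (fun i => enum_val i), (fun i => (lr i).1), (fun i => (lr i).2).
split=> [||i|i|i]; try by case: (lrP i).
  exact: enum_val_inj.
move=> e; have -> : (e \in D) && crosses a e = (e \in C) by rewrite inE.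
apply/idP/codomP => [eC|[i ->]]; last exact: enum_valP.
by exists (enum_rank_in eC e); rewrite enum_rankK_in.
Qed.

(** * The recurrence and the polynomials *)

Section UntwistedRecurrence.
Variables (K : fieldType) (eps : K) (U : algType K) (Q : 'I_4 -> U).
Local Notation q i := (Q (inord i)).
Hypothesis two_neq0 : (2%:R : K) != 0.
Hypothesis eps2 : eps * eps = 1.
Hypothesis Q0_central : central (q 0).
Hypothesis Q12 : q 1 * q 2 + q 2 * q 1 = q 3.
Hypothesis Q23 : q 2 * q 3 + q 3 * q 2 = eps *: q 1.
Hypothesis Q31 : q 3 * q 1 + q 1 * q 3 = q 2.
Variable c : U.
Hypothesis cE : c = q 0 ^+ 2 + eps *: q 1 ^+ 2 + q 2 ^+ 2 + q 3 ^+ 2.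
Hypothesis c_central : central c.
Variables (N : nat) (w : 'I_N -> {set {set 'I_N}} -> U).
Hypothesis wE : forall t D, chord_diagram D ->
  embed (w t D) = twisted_weight eps (twist Q) (cut t) D.

Section Chord.
Variables (D : {set {set 'I_N}}) (a : {set 'I_N}) (x y : 'I_N).
Variables (k : nat) (b : 'I_k -> {set 'I_N}) (l r : 'I_k -> 'I_N).
Hypothesis D_diagram : chord_diagram D.
Hypothesis aD : a \in D.
Hypothesis a_ends : a = [set x; y].
Hypothesis b_inj : injective b.
Hypothesis b_cross : forall e, ((e \in D) && crosses a e) = (e \in codom b).
Hypothesis b_ends : forall i, b i = [set l i; r i].
Hypothesis l_arc : forall i, cyc x (l i) y.
Hypothesis r_arc : forall i, cyc y (r i) x.

Local Notation Da := (D :\ a).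
Local Notation Dai i := (Da :\ b i).
Local Notation Daij i j := (Da :\ b i :\ b j).
Local Notation par i j :=
  (add_chord (add_chord (Daij i j) (l i) (l j)) (r i) (r j)).
Local Notation cross i j :=
  (add_chord (add_chord (Daij i j) (l i) (r j)) (r i) (l j)).
Local Notation lr i j := (add_chord (Daij i j) (l i) (r j)).
Local Notation rl i j := (add_chord (Daij i j) (r i) (l j)).
Local Notation ll i j := (add_chord (Daij i j) (l i) (l j)).
Local Notation rr i j := (add_chord (Daij i j) (r i) (r j)).

(** The right-hand side of the recurrence, grouped by chords and pairs of chords,
    with Q_0^2 for c - y. *)
Definition recurrence_rhs (t : 'I_N) : U :=
  c * w t Da - \sum_i eps *: (w t Da - q 0 ^+ 2 * w t (Dai i))
  - \sum_(i < k) \sum_(j < k | (i < j)%N) eps *: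
     ((w t (cross i j) - q 0 ^+ 2 * (w t (lr i j) + w t (rl i j)))
    - (w t (par i j) - q 0 ^+ 2 * (w t (ll i j) + w t (rr i j)))).

Lemma untwisted_recurrence t s1 u s2 : cut t = s1 ++ x :: u ++ y :: s2 ->
  w t D = recurrence_rhs t.
Proof.
move=> cs; apply: (@embed_inj K); rewrite wE //.
have [c2 tD] := chord_diagramP _ D_diagram.
have bD := b_in a_ends b_cross b_ends l_arc.
have arc p : (p \in u) = cyc x p y := mem_arc cs p.
have l_in i : l i \in u by rewrite arc.
have r_out i : r i \notin u by rewrite arc; apply: contraTN (r_arc i) => /cyc_asym ->.
have others e : e \in Da -> e \notin codom b -> {subset e <= u} \/ [disjoint e & u].
  move=> eDa; have := eDa; rewrite in_setD1 -b_cross => /andP[ea eD].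
  rewrite eD /= => ncr.
  have /cards2P[z [v [zv eE]]] : #|e| == 2%N by rewrite c2.
  have nota p : p \in e -> p \notin [set x; y].
    move=> pe; rewrite -a_ends; apply/negP => pa.
    by move: ea; rewrite -(def_pblock tD eD pe) (def_pblock tD aD pa) eqxx.
  move: ncr; rewrite eE a_ends (crosses_arc cs) ?nota ?eE ?inE ?eqxx ?orbT //.
  case: (boolP (z \in u)) => zu; case: (boolP (v \in u)) => //= vu _; [left|right].
    by move=> p; rewrite !inE => /orP[] /eqP->.
  rewrite disjoint_subset; apply/subsetP => p; rewrite !inE.
  by case/orP=> /eqP->.
have cc : central (casimir_elt eps (twist Q)).
  by rewrite twist_casimir -cE; apply: embed_central.
rewrite (twisted_weight_recurrence eps2 (twist_triple Q0_central Q12 Q23 Q31) cc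
  (cut_uniq t) (mem_cut t) cs tD c2 aD a_ends b_inj bD b_ends l_in r_out others two_neq0).
have cDa := chord_diagram_Da a D_diagram; have cDai := chord_diagram_Dai a b D_diagram.
have ZE : twist Q ord0 = embed (q 0) by rewrite -inord0E /twist gam_inord.
have eM u1 u2 : embed (u1 * u2) = embed u1 * embed u2 by rewrite rmorphM.
have eB (u1 u2 : U) : embed (u1 - u2) = embed u1 - embed u2 by rewrite linearB.
have eD (u1 u2 : U) : embed (u1 + u2) = embed u1 + embed u2 by rewrite linearD.
rewrite /recurrence_rhs !linearB /= eM !linear_sum /= -!wE // twist_casimir -cE ZE.
congr (_ + _ + _); apply: eq_bigr => i _; congr (- _).
  by rewrite linearZ /= eB eM rmorphXn /= -!wE.
rewrite linear_sum /=; apply: eq_bigr => j ij.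
have bij : b i != b j by apply: contraTneq ij => /b_inj->; rewrite ltnn.
have [cll crr clr crl [cpar ccross]] := resolved_diagrams D_diagram a_ends b_cross b_ends l_arc r_arc bij.
by rewrite linearZ /= !expr2 !(eB, eM, eD) !wE.
Qed.

End Chord.

(** Exchanging the two sides of the chord a. *)
Lemma recurrence_rhs_swap D a k (b : 'I_k -> {set 'I_N}) l r t :
  recurrence_rhs D a b r l t = recurrence_rhs D a b l r t.
Proof.
congr (_ - _ - _); apply: eq_bigr => i _; apply: eq_bigr => j _.
congr (_ *: (_ - _ - (_ - _))); rewrite /add_chord.
- by rewrite setUCA.
- by rewrite addrC.
- by rewrite setUCA.
- by rewrite addrC.
Qed.

Lemma untwisted_recurrence_any D a x y k (b : 'I_k -> {set 'I_N}) l r t :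
  chord_diagram D -> a \in D -> a = [set x; y] -> injective b ->
  (forall e, ((e \in D) && crosses a e) = (e \in codom b)) ->
  (forall i, b i = [set l i; r i]) ->
  (forall i, cyc x (l i) y) -> (forall i, cyc y (r i) x) ->
  w t D = recurrence_rhs D a b l r t.
Proof.
move=> cD aD aE binj bcr be lx ry.
have xy : x != y.
  by have [/(_ a aD)] := chord_diagramP _ cD; rewrite aE cards2; case: eqP.
have [[s1 [u [s2 cs]]]|[s1 [u [s2 cs]]]] := cut_split2 t xy.
  exact: (untwisted_recurrence cD aD aE binj bcr be lx ry cs).
rewrite -recurrence_rhs_swap; apply: (untwisted_recurrence cD aD _ binj bcr _ ry lx cs).
  by rewrite aE setUC.
by move=> i; rewrite be setUC.
Qed.

Lemma recurrence_rhsE D a k (b : 'I_k -> {set 'I_N}) l r t (y := c - q 0 ^+ 2) :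
  let Da := D :\ a in
  let Dai i := Da :\ b i in
  let Daij i j := Da :\ b i :\ b j in
  let par i j := add_chord (add_chord (Daij i j) (l i) (l j)) (r i) (r j) in
  let cross i j := add_chord (add_chord (Daij i j) (l i) (r j)) (r i) (l j) in
  let lr i j := add_chord (Daij i j) (l i) (r j) in
  let rl i j := add_chord (Daij i j) (r i) (l j) in
  let ll i j := add_chord (Daij i j) (l i) (l j) in
  let rr i j := add_chord (Daij i j) (r i) (r j) in
  recurrence_rhs D a b l r t
  = (c - (eps * k%:R)%:A) * w t Da
    + eps *: (c - y) * (\sum_(i < k) w t (Dai i))
    + eps *: (\sum_(i < k) \sum_(j < k | (i < j)%N)
                (w t (par i j) - w t (cross i j)))
    + eps *: (c - y) *
        (\sum_(i < k) \sum_(j < k | (i < j)%N)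
           (w t (lr i j) + w t (rl i j) - w t (ll i j) - w t (rr i j))).
Proof.
move=> Da Dai Daij par cross lr rl ll rr; rewrite /recurrence_rhs.
have -> : c - y = q 0 ^+ 2 by rewrite subKr.
set z := q 0 ^+ 2; rewrite mulrBl -!addrA; congr (_ + _).
rewrite -!scaler_sumr.
have -> : \sum_(i < k) (w t Da - z * w t (Dai i))
    = k%:R *: w t Da - z * \sum_(i < k) w t (Dai i).
  by rewrite sumrB sumr_const card_ord scaler_nat mulr_sumr.
have -> : \sum_(i < k) \sum_(j < k | (i < j)%N) eps *:
     ((w t (cross i j) - z * (w t (lr i j) + w t (rl i j)))
    - (w t (par i j) - z * (w t (ll i j) + w t (rr i j))))
  = - (eps *: (\sum_(i < k) \sum_(j < k | (i < j)%N) (w t (par i j) - w t (cross i j))))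
    - eps *: (z * \sum_(i < k) \sum_(j < k | (i < j)%N)
      (w t (lr i j) + w t (rl i j) - w t (ll i j) - w t (rr i j))).
  rewrite -opprD -scalerDr mulr_sumr -big_split -scalerN -sumrN scaler_sumr /=.
  apply: eq_bigr => i _; rewrite mulr_sumr -big_split -sumrN scaler_sumr /=.
  apply: eq_bigr => j _; congr (_ *: _).
  rewrite !mulrBr !mulrDr !opprD !opprK.
  by rewrite addrACA (addrC (w t (cross i j))) !addrA.
by rewrite scalerBr scalerA mulr_algl -!scalerAl !opprD !opprK addrA.
Qed.

Section Polynomials.
Local Notation y := (c - q 0 ^+ 2).

Lemma y_central : central y.
Proof.
move=> v; rewrite mulrBl mulrBr c_central expr2.
by rewrite -mulrA Q0_central mulrA -[in RHS]Q0_central mulrA -!mulrA Q0_central.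
Qed.

Lemma y_comm : commr_rmorph (horner_alg c) y.
Proof. by move=> p; apply: y_central. Qed.

(** Evaluation of a polynomial in two variables at the central elements y, c. *)
Definition eval2 (P : {poly {poly K}}) : U := (map_poly (horner_alg c) P).[y].

Lemma eval2E P : eval2 P = horner_morph y_comm P.
Proof. by []. Qed.

(** A family indexed by the cuts, given by one polynomial for all cuts. *)
Definition polynomial_in_cy (v : 'I_N -> U) : Prop :=
  exists P, forall t, v t = eval2 P.

Lemma poly_cyD u v : polynomial_in_cy u -> polynomial_in_cy v ->
  polynomial_in_cy (fun t => u t + v t).
Proof.
by move=> [P uP] [R vR]; exists (P + R) => t; rewrite uP vR !eval2E rmorphD.
Qed.

Lemma poly_cyM u v : polynomial_in_cy u -> polynomial_in_cy v ->
  polynomial_in_cy (fun t => u t * v t).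
Proof.
by move=> [P uP] [R vR]; exists (P * R) => t; rewrite uP vR !eval2E rmorphM.
Qed.

Lemma poly_cy_alg (z : K) : polynomial_in_cy (fun=> z%:A).
Proof.
by exists (z%:P)%:P => t; rewrite eval2E /= horner_morphC /= horner_algC.
Qed.

Lemma poly_cy_c : polynomial_in_cy (fun=> c).
Proof. by exists ('X)%:P => t; rewrite eval2E /= horner_morphC /= horner_algX. Qed.

Lemma poly_cy_y : polynomial_in_cy (fun=> y).
Proof. by exists 'X => t; rewrite eval2E /= horner_morphX. Qed.

Lemma poly_cyZ (z : K) u : polynomial_in_cy u -> polynomial_in_cy (fun t => z *: u t).
Proof.
move=> /(poly_cyM (poly_cy_alg z))[P uP]; exists P => t.
by rewrite -(uP t) mulr_algl.
Qed.

Lemma poly_cyB u v : polynomial_in_cy u -> polynomial_in_cy v ->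
  polynomial_in_cy (fun t => u t - v t).
Proof.
move=> pu /(poly_cyZ (-1))/(poly_cyD pu)[P vP]; exists P => t.
by rewrite -(vP t) scaleN1r.
Qed.

Lemma poly_cy_sum (T : Type) (s : seq T) (C : pred T) (u : T -> 'I_N -> U) :
  (forall i, C i -> polynomial_in_cy (u i)) ->
  polynomial_in_cy (fun t => \sum_(i <- s | C i) u i t).
Proof.
move=> pu; elim: s => [|i s [P sP]].
  by exists 0 => t; rewrite big_nil eval2E rmorph0.
have [Ci|nCi] := boolP (C i); last by exists P => t; rewrite big_cons (negPf nCi).
have [R iR] := poly_cyD (pu i Ci) (ex_intro _ P sP).
by exists R => t; rewrite big_cons Ci.
Qed.

Lemma poly_cy_q : polynomial_in_cy (fun=> q 0 ^+ 2).
Proof.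
by have [P yP] := poly_cyB poly_cy_c poly_cy_y; exists P => t; rewrite -(yP t) subKr.
Qed.

Theorem weight_polynomial D : chord_diagram D -> polynomial_in_cy (w^~ D).
Proof.
have [n] := ubnP #|D|; elim: n => // n IH in D * => Dn cD.
have [D0|/set0Pn[a aD]] := eqVneq D set0.
  exists 1 => t; rewrite eval2E rmorph1; apply: (@embed_inj K).
  by rewrite wE // D0 /twisted_weight state_sum0 rmorph1 /word big1.
have [c2 tD] := chord_diagramP _ cD.
have /cards2P[x [x' [_ aE]]] : #|a| == 2%N by rewrite c2.
have [k [b [l [r [binj bcr be lx rx]]]]] := crossing_chords cD aD aE.
have bD := b_in aE bcr be lx.
have rec t := untwisted_recurrence_any t cD aD aE binj bcr be lx rx.
suff [P recP] : polynomial_in_cy (recurrence_rhs D a b l r).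
  by exists P => t; rewrite rec.
have bDi i : b i \in D by have := bD i; rewrite in_setD1 => /andP[].
have cDa : chord_diagram (D :\ a) := chord_diagram_Da a cD.
have cDai i : chord_diagram (D :\ a :\ b i) := chord_diagram_Dai a b cD i.
have ca : #|D| = #|D :\ a|.+1 by rewrite (cardsD1 a) aD.
have cb i : #|D :\ a| = #|D :\ a :\ b i|.+1 by rewrite (cardsD1 (b i)) bD.
have cA (D' : {set {set 'I_N}}) p q : (#|add_chord D' p q| <= #|D'|.+1)%N.
  by rewrite cardsU1; case: (_ \notin _).
have IHa : polynomial_in_cy (w^~ (D :\ a)) by apply: IH; rewrite // -ltnS -ca.
have IHb i : polynomial_in_cy (w^~ (D :\ a :\ b i)).
  by apply: IH; rewrite // -ltnS; move: Dn; rewrite ca (cb i); lia.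
apply: poly_cyB; first apply: poly_cyB.
- exact: poly_cyM poly_cy_c IHa.
- apply: poly_cy_sum => i _; apply: poly_cyZ; apply: poly_cyB => //.
  by apply: poly_cyM => //; apply: poly_cy_q.
apply: poly_cy_sum => i _; apply: poly_cy_sum => j ij; apply: poly_cyZ.
have bij : b i != b j by apply: contraTneq ij => /binj->; rewrite ltnn.
have cij : (#|D :\ a| = #|D :\ a :\ b i :\ b j|.+2)%N.
  by rewrite (cb i) (cardsD1 (b j)) in_setD1 eq_sym bij bD.
have [cll crr clr crl [cpar ccross]] := resolved_diagrams cD aE bcr be lx rx bij.
have small (D' : {set {set 'I_N}}) : (#|D'| <= #|D :\ a :\ b i :\ b j|.+2)%N -> chord_diagram D' ->
    polynomial_in_cy (w^~ D').
  by move=> sD'; apply: IH; rewrite (leq_ltn_trans sD') // -cij -ltnS -ca.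
have one p p' := leqW (cA (D :\ a :\ b i :\ b j) p p').
have two p p' z z' : (#|add_chord (add_chord (D :\ a :\ b i :\ b j) p p') z z'|
    <= #|D :\ a :\ b i :\ b j|.+2)%N.
  by apply: leq_trans (cA _ _ _) _; rewrite ltnS cA.
apply: poly_cyB; apply: poly_cyB; try (exact: small); apply: poly_cyM poly_cy_q _.
  by apply: poly_cyD; apply: small.
by apply: poly_cyD; apply: small.
Qed.

End Polynomials.

End UntwistedRecurrence.

Theorem theorem4p1 (K : fieldType) (eps : K) (N : nat)
  (D : {set {set 'I_N}}) (a : {set 'I_N}) (top bot : 'I_N)
  (k : nat) (b : 'I_k -> {set 'I_N}) (l r : 'I_k -> 'I_N)
  (char0 : [pchar K] =i pred0) (eps_sign : eps = 1 \/ eps = -1)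
  (D_diagram : chord_diagram D) (a_in_D : a \in D)
  (* a is drawn vertically and the circle is oriented counterclockwise, so the
     left arc runs from the top end of a to its bottom end *)
  (a_ends : a = [set top; bot])
  (b_inj : injective b)
  (b_cross : forall e, ((e \in D) && crosses a e) = (e \in codom b))
  (b_ends : forall i, b i = [set l i; r i])
  (l_left : forall i, cyc top (l i) bot)
  (r_right : forall i, cyc bot (r i) top) :
  let w := @weight N K eps in
  let c := casimir eps in
  let y := casimir_y eps in
  let Da := D :\ a in
  let Dai i := Da :\ b i in
  let Daij i j := Da :\ b i :\ b j in
  let par i j := add_chord (add_chord (Daij i j) (l i) (l j)) (r i) (r j) in
  let cross i j := add_chord (add_chord (Daij i j) (l i) (r j)) (r i) (l j) in
  let lr i j := add_chord (Daij i j) (l i) (r j) in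
  let rl i j := add_chord (Daij i j) (r i) (l j) in
  let ll i j := add_chord (Daij i j) (l i) (l j) in
  let rr i j := add_chord (Daij i j) (r i) (r j) in
  (exists P : {poly {poly K}},
     forall t, w t D = (map_poly (horner_alg c) P).[y]) /\
  (forall t,
     w t D =
       (c - (eps * k%:R)%:A) * w t Da
       + eps *: (c - y) * (\sum_(i < k) w t (Dai i))
       + eps *: (\sum_(i < k) \sum_(j < k | (i < j)%N)
                   (w t (par i j) - w t (cross i j)))
       + eps *: (c - y) *
           (\sum_(i < k) \sum_(j < k | (i < j)%N)
              (w t (lr i j) + w t (rl i j) - w t (ll i j) - w t (rr i j)))).
Proof.
move=> w c y Da Dai Daij par cross lr rl ll rr.
have two0 : (2%:R : K) != 0 by move/pcharf0P: char0 => ->.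
have eps2 : eps * eps = 1.
  by case: eps_sign => ->; rewrite ?mulrNN mulr1.
have cC := @casimir_central K eps; have wE := @embed_weight K eps N.
have Q12 := Qgen12 eps; have Q23 := Qgen23 eps; have Q31 := Qgen31 eps.
have Q0 := @Qgen0_central K eps.
split.
  exact: (weight_polynomial two0 eps2 Q0 Q12 Q23 Q31 erefl cC wE D_diagram).
move=> t; apply: etrans (recurrence_rhsE _ _ _ _ _ _ _ _ _ _).
exact: (untwisted_recurrence_any two0 eps2 Q0 Q12 Q23 Q31 erefl cC wE t D_diagram a_in_D
  a_ends b_inj b_cross b_ends l_left r_right).
Qed.
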